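(* As $n\to\infty$, $$\mathrm{ou}(n) \sim \frac{e^{\pi\sqrt{\frac{2n}{3}}}}{2^{\frac{13}{4}}\,3^{\frac14}\,n^{\frac34}}.$$
   Context: An odd unimodal sequence of weight $n$ is a sequence of odd positive integers of the form $a_1\le\cdots\le a_r\le \overline{c}\ge b_1\ge\cdots\ge b_s$ (with $r,s\ge 0$) having a distinguished (marked) entry $c$, called the peak, such that $n=c+\sum_{j=1}^r a_j+\sum_{j=1}^s b_j$. Sequences with the same entries but differently marked peak positions are counted as different. $\mathrm{ou}(n)$ denotes the number of odd unimodal sequences of weight $n$ (for example $\mathrm{ou}(4)=6$). The notation $f(n)\sim g(n)$ means $f(n)/g(n)\to1$. *)

(* Defs.v *)
From HB Require Import structures.
From mathcomp Require Import all_boot all_order all_algebra.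
From mathcomp Require Import finmap.
From mathcomp Require Import all_classical.

Set Implicit Arguments.
Unset Strict Implicit.
Unset Printing Implicit Defensive.

Local Open Scope classical_set_scope.
Local Open Scope nat_scope.

(* The triple (a, c, b) encodes the sequence a ++ c :: b whose marked entry is
   the displayed c, so that two markings of one sequence are distinct triples. *)
Notation marked_seq := (seq nat * nat * seq nat)%type.

(* Positivity of the entries follows from their being odd. *)
Definition odd_unimodal (t : marked_seq) : bool :=
  let: (a, c, b) := t in
  [&& all odd (a ++ c :: b), sorted leq (rcons a c) & sorted geq (c :: b)].

Definition weight (t : marked_seq) : nat :=
  let: (a, c, b) := t in sumn a + c + sumn b.

Definition odd_unimodal_of_weight (n : nat) : set marked_seq :=
  [set t | odd_unimodal t /\ weight t = n].

Definition ou (n : nat) : nat := #|` fset_set (odd_unimodal_of_weight n)|%fset.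

Lemma odd_seq_bounded (n : nat) (s : seq nat) :
  all odd s -> sumn s <= n -> exists u : n.-bseq 'I_n.+1, map val u = s.
Proof.
move=> os sn.
have szs : size s <= n.
  apply: leq_trans sn; elim: s os => //= x s IHs /andP[ox /IHs].
  by case: x ox => // x _; rewrite addSn ltnS => /leq_trans; apply; exact: leq_addl.
have alls : all (fun x => x < n.+1) s.
  apply/allP => x xs; rewrite ltnS; apply: leq_trans sn.
  elim: s xs {os szs} => //= y s IHs; rewrite in_cons => /orP[/eqP->|/IHs].
    exact: leq_addr.
  by move=> /leq_trans; apply; exact: leq_addl.
have szu : size (map (fun x => inord x : 'I_n.+1) s) <= n by rewrite size_map.
exists (Bseq szu) => /=; rewrite -map_comp -[RHS]map_id.
by apply/eq_in_map => x xs /=; rewrite inordK//; exact: (allP alls).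
Qed.

(* Otherwise fset_set would take its default value in the definition of ou. *)
Lemma finite_odd_unimodal_of_weight (n : nat) :
  finite_set (odd_unimodal_of_weight n).
Proof.
pose f (u : n.-bseq 'I_n.+1 * 'I_n.+1 * n.-bseq 'I_n.+1) : marked_seq :=
  (map val u.1.1, val u.1.2, map val u.2).
apply: (@sub_finite_set _ _ (f @` setT)); last first.
  by apply: finite_image; exact: finite_finset.
move=> [[a c] b] [/and3P[]]; rewrite all_cat/= => /and3P[oa _ ob] _ _ abc.
have [u ua] := odd_seq_bounded (n := n) oa ltac:(by rewrite -abc -addnA leq_addr).
have [v vb] := odd_seq_bounded (n := n) ob ltac:(by rewrite -abc leq_addl).
have cn : c < n.+1 by rewrite ltnS -abc addnAC leq_addl.
by exists (u, Ordinal cn, v); rewrite // /f /= ua vb.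
Qed.

(* Main.v *)
Require Import Defs.
From HB Require Import structures.
From mathcomp Require Import all_boot all_order all_algebra.
From mathcomp Require Import finmap complex zify ring lra.
From mathcomp Require Import all_classical all_reals all_analysis.
From mathcomp Require Import measurable_realfun.

(* Marking the larger of the two leading parts turns a pair of partitions into
   odd parts into an odd unimodal sequence, and raising the peak by 2 makes it
   strictly larger than all other parts; hence, with pp(n) the number of pairs
   of partitions into odd parts of total weight n,
     pp(n) <= 2 ou(n) <= pp(n + 2)   (n > 0),
   and it suffices to find the asymptotics of pp(n).  By Euler's theorem pp(n)
   is the coefficient of q^n in P(q) = prod_(k <= N) (1 + q^k)^2 for any
   N >= n.  Put q = e^-t with t = pi / sqrt (6 n).  Then pp(n) q^n / P(q) is the
   probability that a sum of independent Bernoulli variables weighted by their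
   index equals n.  The expansion log P(q) = pi^2 / (6 t) - log 2 + O(t), a
   consequence of eta(2) = pi^2 / 12, also gives by convexity the mean and the
   variance of this sum, and a local limit theorem (Fourier inversion and
   dominated convergence) concludes. *)

Set Implicit Arguments.
Unset Strict Implicit.
Unset Printing Implicit Defensive.

Import Order.TTheory GRing.Theory Num.Theory.
Import numFieldNormedType.Exports.

Local Open Scope classical_set_scope.
Local Open Scope ring_scope.

(** * Partitions into odd parts and odd unimodal sequences *)

(** Everything is done with polynomials truncated at [N]: for each n a single [N] is chosen so large
    that all estimates hold at once, and no infinite product occurs. The choice of t makes the
    approximate mean pi^2 / (6 t^2) equal to n; then n t and log P(q) contribute pi^2 / (6 t) each
    to the exponent. The obstacle is that an asymptotic expansion cannot simply be differentiated:
    the error in log P(q) is only known to be bounded by a multiple of t. Convexity turns difference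
    quotients into two-sided bounds, with step t^2 for the mean and t^(3/2) for the variance. The
    precision obtained is enough: the mean is off by O(1 / t), which is small against a standard
    deviation of order t^(-3/2), and only the leading term pi^2 / (3 t^3) of the variance matters.
    The passage from pp to ou costs a factor 2 only because pp(n + 2) / pp(n) tends to 1. *)

Section OddPartitions.

Local Open Scope nat_scope.

(** The allowed parts are the [m] smallest odd numbers and [i] is the multiplicity of the largest of
    them, so that the recursion follows the product of the 1 / (1 - x^(2j+1)) factor by factor. *)
Fixpoint odd_partitions (m k : nat) : seq (seq nat) :=
  if m is m'.+1 then
    [seq nseq i m'.*2.+1 ++ s | i <- iota 0 k.+1, s <-
      if i * m'.*2.+1 <= k then odd_partitions m' (k - i * m'.*2.+1) else [::]]
  else if k == 0 then [:: [::]] else [::].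

Lemma odd_partitionsS (m k : nat) :
  odd_partitions m.+1 k = [seq nseq i m.*2.+1 ++ s | i <- iota 0 k.+1, s <-
    if i * m.*2.+1 <= k then odd_partitions m (k - i * m.*2.+1) else [::]].
Proof. by []. Qed.

Arguments odd_partitions : simpl never.

Definition odd_partition (s : seq nat) : bool := all odd s && sorted geq s.

Lemma geq_trans : transitive geq.
Proof. by move=> y x z /= yx zy; exact: leq_trans zy yx. Qed.

Lemma sorted_geq_split (p : nat) (s : seq nat) :
  sorted geq s -> all (fun x => x <= p) s ->
  s = nseq (count_mem p s) p ++ [seq x <- s | x != p].
Proof.
elim: s => //= x s IHs xs /andP[xp sp].
have [->|xNp] /= := eqVneq x p.
  by congr (_ :: _); apply: IHs => //; exact: path_sorted xs.
have xltp : x < p by rewrite ltn_neqAle xNp.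
have sx : all (fun y => y < p) s.
  apply: sub_all (order_path_min geq_trans xs) => y /=.
  by move=> yx; exact: leq_ltn_trans yx xltp.
have -> : count_mem p s = 0.
  apply/eqP; rewrite -leqn0 leqNgt -has_count; apply/hasP => -[y ys /= /eqP yp].
  by have := allP sx y ys; rewrite yp ltnn.
rewrite /=; congr (_ :: _); apply/esym/all_filterP.
by apply: sub_all sx => y /=; rewrite ltn_neqAle => /andP[].
Qed.

Lemma mem_odd_partitions (m k : nat) (s : seq nat) :
  (s \in odd_partitions m k) =
  [&& odd_partition s, all (fun x => x < m.*2) s & sumn s == k].
Proof.
elim: m k s => [|m IHm] k s.
  by case: k s => [|k] [|x s] //; rewrite /= !andbF.
rewrite odd_partitionsS; apply/allpairsPdep/idP => [[i [s' [_ + ->]]]|].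
  case: ifP => // ik; rewrite IHm => /and3P[/andP[os ss] ls /eqP sk].
  rewrite /odd_partition !all_cat os !all_nseq/= odd_double /= !orbT /=.
  rewrite sumn_cat sumn_nseq sk mulnC.
  have -> : i * m.*2.+1 + (k - i * m.*2.+1) == k by rewrite subnKC.
  have -> : (i == 0) || (m.*2.+1 < m.+1.*2) by rewrite doubleS ltnSn orbT.
  rewrite andbT/=; apply/andP; split; last first.
    by apply: sub_all ls => x xm; rewrite doubleS; lia.
  elim: i {ik sk} => //= i IHi; case: i IHi => [_|i] //=.
    case: s' os ss ls => //= x s' _ xs /andP[xm _]; rewrite xs andbT; lia.
  by rewrite leqnn.
case/and3P => /andP[os ss] ls /eqP sk.
have lp : all (fun x => x <= m.*2.+1) s.
  by apply: sub_all ls => x; rewrite doubleS ltnS.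
have sE := sorted_geq_split ss lp.
set i := count_mem _ _ in sE; set s' := [seq x <- s | _] in sE.
have sumE : i * m.*2.+1 + sumn s' = k by rewrite -sk sE sumn_cat sumn_nseq mulnC.
exists i, s'; split=> //.
  rewrite mem_iota /= add0n ltnS; nia.
have -> : i * m.*2.+1 <= k by lia.
rewrite IHm; apply/and3P; split.
- apply/andP; split; first by rewrite all_filter; apply: sub_all os => x /= ->; rewrite implybT.
  by apply: sorted_filter ss; exact: geq_trans.
- rewrite all_filter; apply/allP => x xs /=; apply/implyP => xNp.
  have := allP lp x xs; have := allP os x xs; move/eqP: xNp; lia.
- by apply/eqP; lia.
Qed.

Lemma uniq_odd_partitions (m k : nat) : uniq (odd_partitions m k).
Proof.
elim: m k => [|m IHm] k; first by case: k.
rewrite odd_partitionsS; apply: allpairs_uniq_dep; first exact: iota_uniq.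
  by move=> i _; case: ifP.
move=> _ _ /allpairsPdep[i [s [_ si ->]]] /allpairsPdep[j [s' [_ sj ->]]] /=.
(* The multiplicity [i] can be read off a member, because the remaining parts are all below
   [m.*2.+1]. *)
have count0 (i0 : nat) (u : seq nat) :
    u \in (if i0 * m.*2.+1 <= k then odd_partitions m (k - i0 * m.*2.+1) else [::]) ->
    count_mem m.*2.+1 u = 0.
  case: ifP => // _; rewrite mem_odd_partitions => /and3P[_ lu _].
  apply/eqP; rewrite -leqn0 leqNgt -has_count; apply/hasP => -[y ys /= /eqP yp].
  by have := allP lu y ys; rewrite yp; lia.
move=> ssE.
have ij : i = j.
  have /(congr1 (count_mem m.*2.+1)) := ssE.
  by rewrite !count_cat (count0 _ _ si) (count0 _ _ sj) !count_nseq /= eqxx; lia.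
subst j; congr (existT _ _ _).
by move/eqP: ssE; rewrite eqseq_cat// eqxx => /eqP.
Qed.

(** Allowing [n.+1] part sizes is no restriction on partitions of weight at most [n]. *)
Definition odd_partition_pairs (n : nat) : seq (seq nat * seq nat) :=
  [seq u | i <- iota 0 n.+1, u <-
    [seq (a, b) | a <- odd_partitions n.+1 i, b <- odd_partitions n.+1 (n - i)]].

Lemma odd_partition_lt (m : nat) (s : seq nat) :
  sumn s <= m -> all (fun x => x < m.+1.*2) s.
Proof.
elim: s => //= x s IHs xsm; rewrite IHs ?andbT; last by lia.
by rewrite doubleS; lia.
Qed.

Lemma mem_odd_partition_pairs (n : nat) (a b : seq nat) :
  ((a, b) \in odd_partition_pairs n) =
  [&& odd_partition a, odd_partition b & sumn a + sumn b == n].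
Proof.
apply/allpairsPdep/idP.
  move=> [i [u [+ + uE]]]; rewrite mem_iota add0n ltnS => /= im.
  rewrite -uE => /allpairsP[[a' b'] /= [+ + [-> ->]]].
  rewrite !mem_odd_partitions => /and3P[-> _ /eqP ->] /and3P[-> _ /eqP ->] /=.
  by rewrite subnKC.
case/and3P => pa pb /eqP abn; exists (sumn a), (a, b); split=> //.
  by rewrite mem_iota; lia.
apply/allpairsP; exists (a, b); rewrite !mem_odd_partitions pa pb !eqxx/= !andbT.
split=> //; first by apply: odd_partition_lt; lia.
by rewrite odd_partition_lt /=; [apply/eqP; lia | lia].
Qed.

Lemma uniq_odd_partition_pairs (n : nat) : uniq (odd_partition_pairs n).
Proof.
apply: allpairs_uniq_dep; first exact: iota_uniq.
  move=> i _; apply: allpairs_uniq; rewrite ?uniq_odd_partitions//.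
  by move=> [? ?] [? ?] /=.
move=> _ _ /allpairsPdep[i [u [_ ui ->]]] /allpairsPdep[j [v [_ vj ->]]] /= uv.
have fst_sum (i0 : nat) (w : seq nat * seq nat) :
    w \in [seq (a, b) | a <- odd_partitions n.+1 i0,
                        b <- odd_partitions n.+1 (n - i0)] -> sumn w.1 = i0.
  move=> /allpairsP[[a b] /= [+ _ ->]].
  by rewrite mem_odd_partitions => /and3P[_ _ /eqP].
by rewrite uv; congr (existT _ _ _); rewrite -(fst_sum _ _ ui) uv (fst_sum _ _ vj).
Qed.

Lemma sizeE_odd_partition_pairs (n : nat) :
  size (odd_partition_pairs n) =
  \sum_(i < n.+1) size (odd_partitions n.+1 i) * size (odd_partitions n.+1 (n - i)).
Proof.
rewrite size_allpairs_dep sumnE big_map.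
rewrite -[iota 0 n.+1]/(index_iota 0 n.+1) big_mkord.
by apply: eq_bigr => i _; rewrite size_allpairs.
Qed.

(** Cutting at the peak leaves two partitions that share their largest part [c]; the rising side has
    to be reversed. *)
Lemma odd_unimodalE (a b : seq nat) (c : nat) :
  odd_unimodal (a, c, b) = odd_partition (c :: rev a) && odd_partition (c :: b).
Proof.
rewrite /odd_unimodal /odd_partition all_cat /= all_rev.
have -> : path geq c (rev a) = sorted leq (rcons a c).
  by rewrite -[LHS]/(sorted geq (c :: rev a)) -rev_rcons rev_sorted.
by case: (all odd a); case: (odd c); case: (all odd b); rewrite /= ?andbF.
Qed.

Definition ou_seq (n : nat) := fset_set (odd_unimodal_of_weight n) : seq marked_seq.

Lemma mem_ou_seq (n : nat) (t : marked_seq) :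
  (t \in ou_seq n) = odd_unimodal t && (weight t == n).
Proof.
rewrite /ou_seq in_fset_set; last exact: finite_odd_unimodal_of_weight.
by apply/idP/andP; rewrite inE /= => -[? /eqP ?]; split.
Qed.

Lemma size_ou_seq (n : nat) : size (ou_seq n) = ou n.
Proof. by []. Qed.

Lemma uniq_ou_seq (n : nat) : uniq (ou_seq n).
Proof. exact: fset_uniq. Qed.

Lemma size_pairs_le_ou (n : nat) :
  0 < n -> size (odd_partition_pairs n) <= (ou n).*2.
Proof.
move=> n0.
pose f1 (t : marked_seq) := let: (a, c, b) := t in (c :: rev a, b).
pose f2 (t : marked_seq) := let: (a, c, b) := t in (b, c :: rev a).
rewrite -addnn -size_ou_seq -{1}(size_map f1 (ou_seq n)) -(size_map f2 (ou_seq n)) -size_cat.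
apply: uniq_leq_size; first exact: uniq_odd_partition_pairs.
move=> [u v]; rewrite mem_odd_partition_pairs mem_cat => /and3P[pu pv /eqP uvn].
(* The side with the larger first part supplies the peak. An empty side has head 0, below every odd
   part; two empty sides are excluded by [0 < n]. *)
have dom x y : odd_partition x -> odd_partition y -> sumn x + sumn y = n ->
    head 0 y <= head 0 x -> exists2 t, t \in ou_seq n & f1 t = (x, y).
  case: x => [|c x] px py xyn yx.
    exfalso; case: y yx {xyn} py (xyn) => [_ _|d y yx py _] /=; first by move: n0; lia.
    by move: py yx => /= /andP[/andP[od _] _] /=; case: d od.
  exists (rev x, c, y); last by rewrite /= revK.
  rewrite mem_ou_seq odd_unimodalE revK px /=; apply/andP; split.
    move: px py; rewrite /odd_partition /= => /andP[/andP[-> _] _] /andP[-> /=].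
    by case: y yx {xyn} => //= d y -> ->.
  by rewrite sumn_rev; apply/eqP; move: xyn => /=; lia.
have [vu|uv] := leqP (head 0 v) (head 0 u).
  by have [t ton <-] := dom _ _ pu pv uvn vu; rewrite map_f.
rewrite addnC in uvn; have [t ton tE] := dom _ _ pv pu uvn (ltnW uv).
apply/orP; right; apply/mapP; exists t => //.
by move: tE; case: t {ton} => -[a c] b /= [-> ->].
Qed.

(* Raising the peak by 2 makes it the strictly largest part, so that it no
   longer matters which of the two sides it is counted on. *)
Lemma ou_le_size_pairs (n : nat) :
  (ou n).*2 <= size (odd_partition_pairs n.+2).
Proof.
pose g1 (t : marked_seq) := let: (a, c, b) := t in (c.+2 :: rev a, b).
pose g2 (t : marked_seq) := let: (a, c, b) := t in (b, c.+2 :: rev a).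
have g1I : injective g1.
  by move=> [[a c] b] [[a' c'] b'] /= [-> /(congr1 rev) + ->]; rewrite !revK => ->.
have g2I : injective g2.
  by move=> [[a c] b] [[a' c'] b'] /= [-> -> /(congr1 rev)]; rewrite !revK => ->.
have raise a b c : odd_unimodal (a, c, b) -> odd_partition (c.+2 :: rev a).
  rewrite odd_unimodalE => /andP[+ _]; rewrite /odd_partition /= negbK.
  move=> /andP[-> /=]; case: (rev a) => //= d s /andP[dc ->].
  by rewrite andbT (leq_trans dc)// ltnW.
rewrite -addnn -size_ou_seq -{1}(size_map g1 (ou_seq n)) -(size_map g2 (ou_seq n)) -size_cat.
apply: uniq_leq_size.
  rewrite cat_uniq !map_inj_uniq// uniq_ou_seq/= andbT.
  (* A common value of [g1] and [g2] would force both [c.+2 <= c'] and [c'.+2 <= c]. *)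
  apply/hasPn => _ /mapP[[[a c] b] abcn ->]; apply/mapP => -[[[a' c'] b'] abcn' [b'E bE]].
  move: abcn abcn'; rewrite !mem_ou_seq !odd_unimodalE b'E -bE /odd_partition /=.
  by move=> /andP[/andP[_ /andP[_ /andP[+ _]]] _] /andP[/andP[_ /andP[_ /andP[+ _]]] _]; lia.
move=> u; rewrite mem_cat => /orP[] /mapP[[[a c] b]];
  rewrite mem_ou_seq => /andP[oabc /= /eqP abc] ->; rewrite mem_odd_partition_pairs;
  rewrite (raise _ _ _ oabc) /=;
  move: oabc; rewrite odd_unimodalE => /andP[_ /andP[/= /andP[oc ob] cb]];
  rewrite /odd_partition ob (path_sorted cb) /= sumn_rev; apply/eqP; lia.
Qed.

End OddPartitions.

(** * Euler's theorem *)

Section EqModX.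
Context {R : comNzRingType}.
Implicit Types p q : {poly R}.

(** Congruence modulo ['X^n.+1], which lets polynomials stand in for power series. *)
Definition eqmodX (n : nat) p q := forall i, (i <= n)%N -> p`_i = q`_i.

Lemma eqmodX_trans n p q r : eqmodX n p q -> eqmodX n q r -> eqmodX n p r.
Proof. by move=> pq qr i ile; rewrite pq// qr. Qed.

Lemma eqmodX_sym n p q : eqmodX n p q -> eqmodX n q p.
Proof. by move=> pq i /pq. Qed.

Lemma eqmodXM n p q p' q' :
  eqmodX n p q -> eqmodX n p' q' -> eqmodX n (p * p') (q * q').
Proof.
move=> pq pq' i ile; rewrite !coefM; apply: eq_bigr => j _.
by rewrite pq ?pq'//; [exact: leq_trans (leq_subr _ _) ile|have := ltn_ord j; lia].
Qed.

Lemma eqmodXMr n p q r : eqmodX n p q -> eqmodX n (r * p) (r * q).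
Proof. by move=> pq; exact: eqmodXM. Qed.

Lemma eqmodXMl n p q r : eqmodX n p q -> eqmodX n (p * r) (q * r).
Proof. by move=> pq; exact: eqmodXM. Qed.

Lemma eqmodX_1D n k c : (n < k)%N -> eqmodX n (1 + c *: 'X^k) 1.
Proof.
move=> nk i ile; rewrite coefD coefZ coefXn.
by rewrite ltn_eqF ?mulr0 ?addr0//; exact: leq_ltn_trans nk.
Qed.

Lemma eqmodX_prod1 n (I : Type) (s : seq I) (P : pred I) (F : I -> {poly R}) :
  (forall i, P i -> eqmodX n (F i) 1) -> eqmodX n (\prod_(i <- s | P i) F i) 1.
Proof.
move=> F1; apply: (big_ind (fun p => eqmodX n p 1)) => // p q p1 q1.
by rewrite -[1]mulr1; exact: eqmodXM.
Qed.

End EqModX.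

(** Either the part [m.*2.+1] is absent or one copy of it can be removed; on generating functions
    this is multiplication by 1 - x^(2m+1). *)
Lemma size_odd_partitionsS (m k : nat) :
  size (odd_partitions m.+1 k) = (size (odd_partitions m k) +
    if m.*2.+1 <= k then size (odd_partitions m.+1 (k - m.*2.+1)) else 0)%N.
Proof.
(* Padding with zeros makes the range of summation flexible, so that the sums for [k] and
   [k - m.*2.+1] differ by an index shift. *)
pose F k i := if (i * m.*2.+1 <= k)%N
  then size (odd_partitions m (k - i * m.*2.+1)) else 0%N.
have sizeE l K : (l < K)%N -> size (odd_partitions m.+1 l) = (\sum_(i < K) F l i)%N.
  move=> lK; rewrite odd_partitionsS size_allpairs_dep sumnE big_map.
  rewrite -[iota 0 l.+1]/(index_iota 0 l.+1) big_mkord.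
  rewrite (big_ord_widen _ (fun i => size (if (i * m.*2.+1 <= l)%N
    then odd_partitions m (l - i * m.*2.+1) else [::])) lK) big_mkcond/=.
  apply: eq_bigr => i _; rewrite /F; case: ltnP => [_|li]; first by case: ifP.
  by rewrite ifN// -ltnNge; nia.
rewrite (sizeE _ k.+2)// big_ord_recl /F mul0n /= subn0; congr addn.
case: ifP => [pk|/negbT]; last first.
  rewrite -ltnNge => kp; rewrite big1// => i _; rewrite ifN// /bump /=; nia.
rewrite (sizeE _ k.+1); last by lia.
apply: eq_bigr => i _; rewrite /F /bump /= add1n mulSn.
by rewrite -leq_subRL// subnDA.
Qed.

Section Euler.
Context {R : idomainType}.

Definition distinct_gf (n : nat) : {poly R} := \prod_(k < n) (1 + 'X^(k.+1)).

Let odd_prod m : {poly R} := \prod_(j < m) (1 - 'X^(j.*2.+1)).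

Lemma eqmodX_distinct_gf (n m : nat) :
  (n <= m)%N -> eqmodX n (distinct_gf m) (distinct_gf n).
Proof.
elim: m => [|m IHm]; first by rewrite leqn0 => /eqP ->.
rewrite leq_eqVlt => /predU1P[->//|]; rewrite ltnS => nm.
rewrite {1}/distinct_gf big_ord_recr /= -[distinct_gf n]mulr1.
apply: eqmodXM; first exact: IHm.
by have := @eqmodX_1D R n m.+1 1 nm; rewrite scale1r.
Qed.

(* Euler's odd-distinct theorem, from [1 + x^k = (1 - x^(2k)) / (1 - x^k)]. *)
Lemma distinct_gf_odd_prod (m : nat) :
  distinct_gf m.*2 * odd_prod m = \prod_(m <= k < m.*2) (1 - 'X^(k.*2.+2)).
Proof.
elim: m => [|m IHm]; first by rewrite /distinct_gf /odd_prod !big_ord0 big_nil mulr1.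
(* The factor of index [m] is missing from the product for [m.+1]; once both sides are multiplied by
   it, that product extends the one in [IHm] by two factors. *)
have Xn1 : 1 - 'X^(m.*2.+2) != 0 :> {poly R}.
  apply/eqP => /(congr1 (fun p : {poly R} => p`_0)) /eqP.
  by rewrite coefB coef1 coefXn coef0 subr0 oner_eq0.
apply: (mulfI Xn1).
have -> : (1 - 'X^(m.*2.+2)) * \prod_(m.+1 <= k < m.+1.*2) (1 - 'X^(k.*2.+2))
   = \prod_(m <= k < m.+1.*2) (1 - 'X^(k.*2.+2)) :> {poly R}.
  by rewrite [RHS]big_ltn// doubleS; lia.
rewrite doubleS !big_nat_recr ?leqW//=; try (rewrite -addnn; exact: leq_addr).
rewrite -IHm /odd_prod big_ord_recr /= /distinct_gf doubleS !big_ord_recr /=.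
set D := \prod_(k < _) _; set O := \prod_(j < m) _.
have -> : 'X^(m.*2.*2.+2) = ('X^(m.*2.+1)) ^+ 2 :> {poly R}.
  by rewrite -exprM; congr ('X^_); lia.
have -> : 'X^(m.*2.+1.*2.+2) = ('X^(m.*2.+2)) ^+ 2 :> {poly R}.
  by rewrite -exprM; congr ('X^_); lia.
ring.
Qed.

Let odd_gf n m : {poly R} := \poly_(k < n.+1) (size (odd_partitions m k))%:R.

Lemma odd_gfK (n m : nat) : eqmodX n (odd_gf n m * odd_prod m) 1.
Proof.
elim: m => [|m IHm].
  rewrite /odd_prod big_ord0 mulr1 => i ile.
  by rewrite coef_poly ltnS ile coef1; case: i {ile}.
apply: eqmodX_trans IHm; rewrite {1}/odd_prod big_ord_recr /= -/(odd_prod m) mulrCA mulrC.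
apply: eqmodXMl => i ile; rewrite mulrBr mulr1 coefB coefMXn !coef_poly !ltnS ile.
rewrite size_odd_partitionsS natrD.
case: leqP => _ /=; first by rewrite subr0 addr0.
by rewrite (leq_trans (leq_subr _ _) ile) addrK.
Qed.

(** Modulo ['X^i.+1] both [odd_gf i m] and [distinct_gf m.*2] are inverses of [odd_prod m], since
    the product in [distinct_gf_odd_prod] has only exponents above [i] besides its constant term. *)
Lemma size_odd_partitions_distinct_gf (n m i : nat) :
  (i < m)%N -> (i <= n)%N -> (size (odd_partitions m i))%:R = (distinct_gf n)`_i.
Proof.
move=> im ile.
have D1 : eqmodX i (distinct_gf m.*2 * odd_prod m) 1.
  rewrite distinct_gf_odd_prod big_nat_cond; apply: eqmodX_prod1 => k.
  rewrite andbT => /andP[mk _]; have := @eqmodX_1D R i k.*2.+2 (-1).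
  by rewrite scaleN1r; apply; lia.
have : eqmodX i (odd_gf i m) (distinct_gf m.*2).
  have -> : odd_gf i m = odd_gf i m * 1 by rewrite mulr1.
  apply: eqmodX_trans (eqmodXMr _ (eqmodX_sym D1)) _.
  rewrite mulrCA -[X in eqmodX _ _ X]mulr1; apply: eqmodXMr; exact: odd_gfK.
move=> /(_ i (leqnn _)); rewrite coef_poly ltnSn => ->.
by rewrite (@eqmodX_distinct_gf i)// -?(@eqmodX_distinct_gf i n)//; lia.
Qed.

Lemma size_odd_partition_pairs (n N : nat) : (n <= N)%N ->
  (size (odd_partition_pairs n))%:R = (distinct_gf N ^+ 2)`_n.
Proof.
move=> nN; rewrite sizeE_odd_partition_pairs expr2 coefM natr_sum.
apply: eq_bigr => i _; rewrite natrM.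
have ile : (i <= n)%N by rewrite -ltnS.
by rewrite !(@size_odd_partitions_distinct_gf N)//; lia.
Qed.

End Euler.

(** * Elementary inequalities *)

Section ElementaryInequalities.
Context {R : realType}.
Implicit Types (x y : R).

Lemma derive_ge0_le (f df : R -> R) (a b : R) : a <= b ->
  (forall x, a <= x <= b -> is_derive x 1 f (df x)) ->
  (forall x, a <= x <= b -> 0 <= df x) -> f a <= f b.
Proof.
move=> ab fE df0; rewrite -subr_ge0.
have [||c] := @MVT_segment R f df a b ab.
- by move=> y; rewrite in_itv /= => /andP[y0 yx]; apply: fE; rewrite !ltW.
- apply: continuous_in_subspaceT => y; rewrite inE /= in_itv /= => yab.
  by apply: differentiable_continuous; apply/derivable1_diffP; have [] := fE y yab.
by rewrite in_itv /= => cab ->; rewrite mulr_ge0 ?df0// subr_ge0.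
Qed.

Lemma derive_ge0_itv (f df : R -> R) (b : R) :
  (forall x, 0 <= x <= b -> is_derive x 1 f (df x)) ->
  (forall x, 0 <= x <= b -> 0 <= df x) -> 0 <= f 0 ->
  forall x, 0 <= x <= b -> 0 <= f x.
Proof.
move=> fE df0 f0 x /andP[x0 xb]; apply: le_trans f0 _.
apply: (derive_ge0_le (df := df)) => // y /andP[y0 yx];
  [apply: fE|apply: df0]; by rewrite y0 (le_trans yx).
Qed.

Lemma derive_ge0 (f df : R -> R) :
  (forall x, 0 <= x -> is_derive x 1 f (df x)) ->
  (forall x, 0 <= x -> 0 <= df x) -> 0 <= f 0 ->
  forall x, 0 <= x -> 0 <= f x.
Proof.
move=> fE df0 f0 x x0; apply: (@derive_ge0_itv f df x) => //; last by rewrite x0 lexx.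
- by move=> y /andP[y0 _]; exact: fE.
- by move=> y /andP[y0 _]; exact: df0.
Qed.

(** This starts a chain of Taylor bounds in which the derivative of each difference is the previous
    difference. *)
Lemma sin_le x : 0 <= x -> sin x <= x.
Proof.
move: x; suff H : forall x, 0 <= x -> 0 <= x - sin x
  by move=> x /H; rewrite subr_ge0.
apply: (@derive_ge0 (fun u => u - sin u) (fun u => 1 - cos u)) => [y _|].
- by rewrite subr_ge0 cos_le1.
- by rewrite sin0 subr0.
Qed.

Lemma cos_ge2 x : 0 <= x -> 1 - x ^+ 2 / 2 <= cos x.
Proof.
move: x; suff H : forall x, 0 <= x -> 0 <= cos x - (1 - x ^+ 2 / 2)
  by move=> x /H; rewrite subr_ge0.
apply: (@derive_ge0 (fun u => cos u - (1 - u ^+ 2 / 2))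
   (fun u => u - sin u)) => [y _|y y0|].
- by apply: is_derive_eq; rewrite /GRing.scale /=; field.
- by rewrite subr_ge0 sin_le.
- by rewrite cos0 expr0n /= mul0r subr0 subrr.
Qed.

Lemma sin_ge3 x : 0 <= x -> x - x ^+ 3 / 6 <= sin x.
Proof.
move: x; suff H : forall x, 0 <= x -> 0 <= sin x - (x - x ^+ 3 / 6)
  by move=> x /H; rewrite subr_ge0.
apply: (@derive_ge0 (fun u => sin u - (u - u ^+ 3 / 6))
   (fun u => cos u - (1 - u ^+ 2 / 2))) => [y _|y y0|].
- by apply: is_derive_eq; rewrite /GRing.scale /=; field.
- by rewrite subr_ge0 cos_ge2.
- by rewrite sin0 expr0n /= mul0r subr0 subrr.
Qed.

Lemma cos_le4 x : 0 <= x -> cos x <= 1 - x ^+ 2 / 2 + x ^+ 4 / 24.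
Proof.
move: x; suff H : forall x, 0 <= x -> 0 <= 1 - x ^+ 2 / 2 + x ^+ 4 / 24 - cos x
  by move=> x /H; rewrite subr_ge0.
apply: (@derive_ge0 (fun u => 1 - u ^+ 2 / 2 + u ^+ 4 / 24 - cos u)
   (fun u => sin u - (u - u ^+ 3 / 6))) => [y _|y y0|].
- by apply: is_derive_eq; rewrite /GRing.scale /=; field.
- by rewrite subr_ge0 sin_ge3.
- by rewrite cos0 !expr0n /= !mul0r; lra.
Qed.

Lemma sin_taylor3 x : `|sin x - x| <= `|x| ^+ 3 / 6.
Proof.
wlog x0 : x / 0 <= x => [H|].
  have [/H//|/ltW x0] := leP 0 x.
  have -> : sin x - x = - (sin (- x) - - x) by rewrite sinN; ring.
  by rewrite normrN -(normrN x) H// oppr_ge0.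
have := sin_le x0; have := sin_ge3 x0.
by rewrite (ger0_norm x0) ler_norml; lra.
Qed.

Lemma cos_taylor4 x : `|cos x - (1 - x ^+ 2 / 2)| <= x ^+ 4 / 24.
Proof.
wlog x0 : x / 0 <= x => [H|].
  have [/H//|/ltW x0] := leP 0 x.
  have -> : x ^+ 2 = (- x) ^+ 2 by ring.
  have -> : x ^+ 4 = (- x) ^+ 4 by ring.
  by rewrite -(cosN x) H// oppr_ge0.
have := cos_ge2 x0; have := cos_le4 x0.
by rewrite ler_norml; lra.
Qed.

Lemma expR_taylor2 x : 0 <= x -> `|expR (- x) - (1 - x)| <= x ^+ 2 / 2.
Proof.
move=> x0; have := expR_ge1Dx (- x).
suff : 0 <= 1 - x + x ^+ 2 / 2 - expR (- x) by rewrite ler_norml; lra.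
move: x x0; apply: (@derive_ge0 (fun u => 1 - u + u ^+ 2 / 2 - expR (- u))
   (fun u => expR (- u) - (1 - u))) => [y _|y y0|].
- by apply: is_derive_eq; rewrite /GRing.scale /=; field.
- by have := expR_ge1Dx (- y); lra.
- by rewrite oppr0 expR0 expr0n /=; lra.
Qed.

Lemma exprn_le_expR (n : nat) x : 0 <= x -> x ^+ n <= n`!%:R * expR x.
Proof.
case: n => [|n] x0; first by rewrite expr0 fact0 mul1r; have := expR_ge1Dx x; lra.
have := expR_ge1Dxn n x0; rewrite -ler_pdivrMl ?ltr0n ?fact_gt0// mulrC.
by apply: le_trans; rewrite lerDr.
Qed.

(** The cubic bound x - x^3 / 6 stays above x / 3 exactly up to x = 2. *)
Lemma sin_ge_third x : 0 <= x <= 2 -> x / 3 <= sin x.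
Proof. by move=> /andP[x0 x2]; have := sin_ge3 x0; nra. Qed.

Lemma mul_cos_le_sin x : 0 <= x <= pi / 2 -> x * cos x <= sin x.
Proof.
move: x; suff H : forall x, 0 <= x <= pi / 2 -> 0 <= sin x - x * cos x
  by move=> x /H; rewrite subr_ge0.
apply: (@derive_ge0_itv (fun u => sin u - u * cos u)
   (fun u => u * sin u)) => [y _|y /andP[y0 yp]|].
- by apply: is_derive_eq; rewrite /GRing.scale /=; ring.
- rewrite mulr_ge0// sin_ge0_pi// y0 (le_trans yp)// ler_pdivrMr// ler_pMr ?pi_gt0//.
  by rewrite ler1n.
- by rewrite sin0 mul0r subr0.
Qed.

Lemma expR_sinh_ge x : 0 <= x -> 2 * x <= expR x - expR (- x).
Proof.
move: x; suff H : forall x, 0 <= x -> 0 <= expR x - expR (- x) - 2 * x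
  by move=> x /H; rewrite subr_ge0.
apply: (@derive_ge0 (fun u => expR u - expR (- u) - 2 * u)
   (fun u => expR u + expR (- u) - 2)) => [y _|y y0|].
- by apply: is_derive_eq; rewrite /GRing.scale /=; ring.
- by have := expR_ge1Dx y; have := expR_ge1Dx (- y); lra.
- by rewrite oppr0 expR0; lra.
Qed.

(** Equivalent to tanh (x / 2) <= x / 2. *)
Lemma expR_tanh_le x : 0 <= x -> 2 * (expR x - 1) <= x * (expR x + 1).
Proof.
move: x; suff H : forall x, 0 <= x -> 0 <= x * (expR x + 1) - 2 * (expR x - 1)
  by move=> x /H; rewrite subr_ge0.
apply: (@derive_ge0 (fun u => u * (expR u + 1) - 2 * (expR u - 1))
   (fun u => u * expR u + 1 - expR u)) => [y _|y y0|].
- by apply: is_derive_eq; rewrite /GRing.scale /=; ring.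
- have := ler_wpM2r (expR_ge0 y) (expR_ge1Dx (- y)).
  by rewrite expRN mulVf ?expR_eq0//; lra.
- by rewrite expR0; lra.
Qed.

Lemma is_derive_exprn (n : nat) x :
  is_derive x (1 : R) (fun u => u ^+ n) (n%:R * x ^+ n.-1).
Proof.
apply: DeriveDef; first exact: exprn_derivable.
by rewrite exp_derive /GRing.scale /= mulr1.
Qed.

Lemma is_derive_ln1D_sum (n : nat) x :
  is_derive x (1 : R) (fun u => \sum_(i < n) (-1) ^+ i * u ^+ i.+1 / i.+1%:R)
    (\sum_(i < n) (-1) ^+ i * x ^+ i).
Proof.
elim: n => [|n IHn].
  under eq_fun do rewrite big_ord0.
  by rewrite big_ord0; exact: is_derive_cst.
under eq_fun do rewrite big_ord_recr.
rewrite big_ord_recr /=; apply: (@is_deriveD _ _ _ _ _ _ _ _ _ IHn).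
have -> : (fun u : R => (-1) ^+ n * u ^+ n.+1 / n.+1%:R) =
    ((-1) ^+ n / n.+1%:R) *: (fun u : R => u ^+ n.+1).
  by apply/funext => u; rewrite mulrAC.
have ? := is_derive_exprn n.+1 x; apply: is_derive_eq; rewrite /GRing.scale /=.
by rewrite mulrA mulfVK// pnatr_eq0.
Qed.

(** The derivative of the error is the remainder (-y)^n / (1 + y) of a geometric sum, at most y^n in
    absolute value. The bound is also used at x = 1, for the series of ln 2. *)
Lemma ln1D_taylor (n : nat) x : 0 <= x ->
  `|ln (1 + x) - \sum_(i < n) (-1) ^+ i * x ^+ i.+1 / i.+1%:R| <= x ^+ n.+1 / n.+1%:R.
Proof.
pose L y := \sum_(i < n) (-1) ^+ i * y ^+ i.+1 / i.+1%:R : R.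
pose dL y := \sum_(i < n) (-1) ^+ i * y ^+ i : R.
have dLE y : 0 <= y -> (1 + y)^-1 - dL y = (- y) ^+ n / (1 + y).
  move=> y0; have y1 : 1 + y != 0 by rewrite gt_eqF// ltr_wpDr.
  have := subrX1 (- y) n.
  have -> : \sum_(i < n) (- y) ^+ i = dL y.
    by apply: eq_bigr => i _; exact: exprNn.
  by move=> /(canRL (subrK 1)) ->; field.
have L0 : L 0 = 0 by rewrite /L big1// => i _; rewrite expr0n /= mulr0 mul0r.
have LD y : is_derive y (1 : R) L (dL y) by exact: is_derive_ln1D_sum.
have lnD y : 0 <= y -> is_derive y (1 : R) (fun u => ln (1 + u)) (1 + y)^-1.
  move=> y0; have y1 : 0 < 1 + y by rewrite ltr_wpDr.
  have ? := is_derive1_ln y1; apply: is_derive_eq.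
  by rewrite /GRing.scale /= add0r mulr1.
have XD y : is_derive y (1 : R) (fun u => n.+1%:R^-1 * u ^+ n.+1) (y ^+ n).
  have ? := is_derive_exprn n.+1 y; apply: is_derive_eq.
  by rewrite /GRing.scale /= mulrA mulVf ?mul1r// pnatr_eq0.
have dbound y : 0 <= y -> `|(1 + y)^-1 - dL y| <= y ^+ n.
  move=> y0; rewrite dLE// normrM normrX normrN (ger0_norm y0) ler_piMr ?exprn_ge0//.
  by rewrite normfV ger0_norm ?invf_le1 ?lerDl ?ltr_wpDr// addr_ge0.
move=> x0; rewrite ler_norml -/(L x); apply/andP; split.
- rewrite -subr_ge0 opprK addrC mulrC.
  apply: (@derive_ge0 (fun u => n.+1%:R^-1 * u ^+ n.+1 + (ln (1 + u) - L u))
    (fun u => u ^+ n + ((1 + u)^-1 - dL u))) x0 => [y y0|y y0|].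
  + by have ? := lnD y y0; exact: is_deriveD.
  + by have := dbound y y0; rewrite ler_norml; lra.
  + by rewrite L0 addr0 ln1 expr0n mulr0 subrr addr0.
- rewrite -subr_ge0 mulrC.
  apply: (@derive_ge0 (fun u => n.+1%:R^-1 * u ^+ n.+1 - (ln (1 + u) - L u))
    (fun u => u ^+ n - ((1 + u)^-1 - dL u))) x0 => [y y0|y y0|].
  + by have ? := lnD y y0; exact: is_deriveB.
  + by have := dbound y y0; rewrite ler_norml; lra.
  + by rewrite L0 addr0 ln1 expr0n mulr0 subrr subr0.
Qed.

(* [x * bernoulli_tail x] is the remainder of the expansion
   [1 / (exp x - 1) = 1 / x - 1 / 2 + ...]. *)
Definition bernoulli_tail x := ((expR x - 1)^-1 - x^-1 + 2^-1) / x.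

Lemma expR_sub1_gt0 x : 0 < x -> 0 < expR x - 1.
Proof. by move=> x0; rewrite subr_gt0 expR_gt1. Qed.

Lemma bernoulli_tail_ge0 x : 0 < x -> 0 <= bernoulli_tail x.
Proof.
move=> x0; have E0 := expR_sub1_gt0 x0.
have -> : bernoulli_tail x = (x * (expR x + 1) - 2 * (expR x - 1)) / (2 * x ^+ 2 * (expR x - 1)).
  by rewrite /bernoulli_tail; field; rewrite !gt_eqF.
by rewrite divr_ge0 ?subr_ge0 ?expR_tanh_le ?(ltW x0)// !mulr_ge0 ?exprn_ge0// ltW.
Qed.

Lemma expR_ge2 x : 0 <= x -> 1 + x + x ^+ 2 / 2 <= expR x.
Proof.
move: x; suff H : forall x, 0 <= x -> 0 <= expR x - (1 + x + x ^+ 2 / 2)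
  by move=> x /H; rewrite subr_ge0.
apply: (@derive_ge0 (fun u => expR u - (1 + u + u ^+ 2 / 2))
   (fun u => expR u - (1 + u))) => [y _|y y0|].
- by apply: is_derive_eq; rewrite /GRing.scale /=; field.
- by rewrite subr_ge0 expR_ge1Dx.
- by rewrite expR0 expr0n /=; lra.
Qed.

(** Only boundedness matters: the value near 0 is close to 1 / 12. With [expR x - 1] replaced by x +
    x^2 / 2, a polynomial with nonnegative coefficients remains. *)
Lemma bernoulli_tail_le1 x : 0 < x -> bernoulli_tail x <= 1.
Proof.
move=> x0; have E0 := expR_sub1_gt0 x0; have E2 := expR_ge2 (ltW x0).
rewrite /bernoulli_tail ler_pdivrMr// mul1r -subr_ge0.
have -> : x - ((expR x - 1)^-1 - x^-1 + 2^-1) =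
    ((expR x - 1) * (1 - x / 2 + x ^+ 2) - x) / (x * (expR x - 1)).
  by field; rewrite !gt_eqF.
apply: divr_ge0; last by rewrite mulr_ge0 ?ltW.
have q0 : 0 <= 1 - x / 2 + x ^+ 2 by nra.
have : (x + x ^+ 2 / 2) * (1 - x / 2 + x ^+ 2) <= (expR x - 1) * (1 - x / 2 + x ^+ 2).
  by apply: ler_wpM2r => //; lra.
suff : 0 <= (x + x ^+ 2 / 2) * (1 - x / 2 + x ^+ 2) - x by lra.
have -> : (x + x ^+ 2 / 2) * (1 - x / 2 + x ^+ 2) - x = x ^+ 3 * (3 / 4) + x ^+ 4 / 2.
  by field.
by rewrite addr_ge0// mulr_ge0 ?exprn_ge0 ?(ltW x0).
Qed.

(** Up to a positive factor, the difference of the two sides is the derivative of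
    [- bernoulli_tail]. Each of [d1], [d2], [d3] concerns the derivative of the preceding function,
    and the last derivative is 2 x sinh x. *)
Lemma cosh_sinh_ge x : 0 <= x ->
  4 * (expR x + expR (- x) - 2) <= 2 * x ^+ 2 + x * (expR x - expR (- x)).
Proof.
have d3 : forall x, 0 <= x -> 0 <= x * (expR x + expR (- x)) - (expR x - expR (- x)).
  apply: (@derive_ge0 (fun u => u * (expR u + expR (- u)) - (expR u - expR (- u)))
    (fun u => u * (expR u - expR (- u)))) => [y _|y y0|].
  - by apply: is_derive_eq; rewrite /GRing.scale /=; ring.
  - by apply: mulr_ge0 => //; have := expR_sinh_ge y0; lra.
  - by rewrite oppr0 expR0; lra.
have d2 : forall x, 0 <= x -> 0 <= 4 + x * (expR x - expR (- x)) - 2 * (expR x + expR (- x)).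
  apply: (@derive_ge0 (fun u => 4 + u * (expR u - expR (- u)) - 2 * (expR u + expR (- u)))
    (fun u => u * (expR u + expR (- u)) - (expR u - expR (- u)))) => [y _|//|].
  - by apply: is_derive_eq; rewrite /GRing.scale /=; ring.
  - by rewrite oppr0 expR0; lra.
have d1 : forall x, 0 <= x -> 0 <= 4 * x + x * (expR x + expR (- x)) - 3 * (expR x - expR (- x)).
  apply: (@derive_ge0 (fun u => 4 * u + u * (expR u + expR (- u)) - 3 * (expR u - expR (- u)))
    (fun u => 4 + u * (expR u - expR (- u)) - 2 * (expR u + expR (- u)))) => [y _|//|].
  - by apply: is_derive_eq; rewrite /GRing.scale /=; ring.
  - by rewrite oppr0 expR0; lra.
move: x; suff H : forall x, 0 <= x ->
   0 <= 2 * x ^+ 2 + x * (expR x - expR (- x)) - 4 * (expR x + expR (- x) - 2).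
  by move=> x /H; rewrite subr_ge0.
apply: (@derive_ge0 (fun u => 2 * u ^+ 2 + u * (expR u - expR (- u)) - 4 * (expR u + expR (- u) - 2))
    (fun u => 4 * u + u * (expR u + expR (- u)) - 3 * (expR u - expR (- u)))) => [y _|//|].
- by apply: is_derive_eq; rewrite /GRing.scale /=; ring.
- by rewrite oppr0 expR0; lra.
Qed.

(** Monotonicity makes the alternating sum of these tails bounded independently of its length, which
    is what yields an O(t) error in [log_sum_asymp]. *)
Lemma bernoulli_tail_anti x y : 0 < x -> x <= y -> bernoulli_tail y <= bernoulli_tail x.
Proof.
move=> x0 xy; rewrite -lerN2.
pose df u := ((u * (expR u ^+ 2 - 1) + 2 * u ^+ 2 * expR u - 4 * (expR u - 1) ^+ 2)) /
  (2 * u ^+ 3 * (expR u - 1) ^+ 2) : R.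
apply: (derive_ge0_le (f := fun u => - bernoulli_tail u) (df := df)) => // u /andP[xu _].
  have u0 := lt_le_trans x0 xu; have E0 := expR_sub1_gt0 u0.
  have nu0 : u != 0 by rewrite gt_eqF.
  have nE0 : expR u - 1 != 0 by rewrite gt_eqF.
  have ? : is_derive u (1 : R) (fun v => (expR v - 1)^-1) (- (expR u - 1) ^- 2 *: (expR u - 0)).
    exact: is_deriveV.
  have ? : is_derive u (1 : R) (fun v => v^-1) (- u ^- 2 *: 1).
    exact: is_deriveV.
  rewrite /bernoulli_tail; apply: is_derive_eq; rewrite /GRing.scale /= /df.
  by field; rewrite nu0 nE0.
have u0 := lt_le_trans x0 xu; have E0 := expR_sub1_gt0 u0.
rewrite /df divr_ge0//; last first.
  by rewrite !mulr_ge0 ?exprn_ge0 ?ltW.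
have := cosh_sinh_ge (ltW u0); move/(ler_wpM2l (expR_ge0 u)).
have := expRxMexpNx_1 u.
move: (expR u) (expR (- u)) => E F EF.
have -> : E * (4 * (E + F - 2)) = 4 * (E - 1) ^+ 2 + 4 * (E * F - 1) by ring.
have -> : E * (2 * u ^+ 2 + u * (E - F)) = u * (E ^+ 2 - E * F) + 2 * u ^+ 2 * E by ring.
by rewrite EF; lra.
Qed.

End ElementaryInequalities.

(** * The value of eta(2) *)

Section Basel.
Context {R : realType}.
Implicit Types (x y : R).

Lemma pi_lt4 : pi < 4 :> R.
Proof. have := @pihalf_lt2 R; lra. Qed.

Lemma sum_mul2 (F : nat -> R) (n : nat) :
  \sum_(i < n.*2) F i = \sum_(i < n) (F i + F (n.*2.-1 - i)%N).
Proof.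
rewrite big_split /= -addnn big_split_ord /=; congr (_ + _).
rewrite (reindex_inj rev_ord_inj) /=; apply: eq_bigr => i _.
by congr F; have := ltn_ord i; lia.
Qed.

Lemma sin_inv2D (x : R) : sin x != 0 -> cos x != 0 ->
  (sin x ^+ 2)^-1 + (cos x ^+ 2)^-1 = 4 * (sin (x *+ 2) ^+ 2)^-1.
Proof.
move=> s0 c0; rewrite sin_mulr2n -mulr_natl.
have -> : (sin x ^+ 2)^-1 + (cos x ^+ 2)^-1 =
    (cos x ^+ 2 + sin x ^+ 2) / (sin x ^+ 2 * cos x ^+ 2) by field; rewrite c0.
by rewrite cos2Dsin2; field; rewrite s0.
Qed.

Let node (M k : nat) : R := (k.*2.+1)%:R * pi / (4 * M%:R).

Lemma node_itv (M k : nat) : (k < M)%N -> 0 < node M k < pi / 2.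
Proof.
move=> kM; have M0 : 0 < M%:R :> R by rewrite ltr0n; lia.
rewrite /node divr_gt0 ?mulr_gt0 ?pi_gt0//= ltr_pdivrMr ?mulr_gt0//.
have -> : pi / 2 * (4 * M%:R) = (M.*2)%:R * pi :> R by rewrite -muln2 natrM; field.
by rewrite ltr_pM2r ?pi_gt0// ltr_nat; lia.
Qed.

(* Pairing the node [x] with [pi / 2 - x] and applying [sin_inv2D] halves the
   number of nodes, down to the single node [pi / 4]. *)
Lemma sum_inv_sin2 (j : nat) :
  \sum_(k < 2 ^ j) (sin (node (2 ^ j) k) ^+ 2)^-1 = 2 * (2 ^ j)%:R ^+ 2 :> R.
Proof.
elim: j => [|j IHj].
  rewrite big_ord_recl big_ord0 addr0 /= (_ : node _ _ = pi / 4); last first.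
    by rewrite /node /= mul1r mulr1.
  have c0 : cos (pi / 4) != 0 :> R.
    by rewrite gt_eqF// cos_gt0_pihalf//; have := @pi_gt0 R; lra.
  have sc : sin (pi / 4) = cos (pi / 4) :> R.
    by have := @tan_piquarter R; rewrite /tan => /(canRL (mulfVK c0)); rewrite mul1r.
  have h := @cos2Dsin2 R (pi / 4); rewrite sc in h; rewrite sc.
  have c20 := expf_neq0 2 c0.
  by apply: (mulfI c20); rewrite divff// expn0 expr1n mulr1 -[LHS]h; ring.
set M := (2 ^ j)%N in IHj *.
have M0 : (0 < M)%N by rewrite expn_gt0.
have M0' : M%:R != 0 :> R by rewrite pnatr_eq0; lia.
have -> : (2 ^ j.+1 = M.*2)%N by rewrite expnS mul2n.
rewrite (sum_mul2 (fun k => (sin (node M.*2 k) ^+ 2)^-1)).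
have -> : 2 * M.*2%:R ^+ 2 = 4 * (2 * M%:R ^+ 2) :> R by rewrite -muln2 natrM; ring.
rewrite -IHj mulr_sumr; apply: eq_bigr => i _.
have iM := ltn_ord i.
have -> : node M.*2 (M.*2.-1 - i) = pi / 2 - node M.*2 i.
  apply/eqP; rewrite eq_sym subr_eq; apply/eqP.
  rewrite /node -mulrDl -mulrDl -natrD.
  have -> : ((M.*2.-1 - i).*2.+1 + i.*2.+1 = M * 4)%N by lia.
  by rewrite -muln2 !natrM; field.
rewrite -(opprB (node _ _)) sinN sinBpihalf opprK.
have /andP[n0 n1] : 0 < node M.*2 i < pi / 2 by apply: node_itv; lia.
rewrite sin_inv2D.
- congr (4 * (sin _ ^+ 2)^-1); rewrite /node -(muln2 M) natrM -mulr_natl.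
  by field; rewrite M0'.
- by rewrite gt_eqF// sin_gt0_pihalf// n0.
- by rewrite gt_eqF// cos_gt0_pihalf// n1 andbT; have := @pi_gt0 R; lra.
Qed.

(** The upper bound is 1 / sin^2 = cot^2 + 1 together with cot x <= 1 / x. *)
Lemma inv_sin2_bounds x : 0 < x < pi / 2 ->
  (x ^+ 2)^-1 <= (sin x ^+ 2)^-1 <= (x ^+ 2)^-1 + 1.
Proof.
move=> /andP[x0 xpi].
have s0 : 0 < sin x by rewrite sin_gt0_pihalf ?x0.
rewrite lef_pV2 ?posrE ?exprn_gt0// ler_sqr ?nnegrE ?(ltW x0) ?(ltW s0)// sin_le ?(ltW x0)//=.
have c0 : 0 <= cos x.
  by rewrite cos_ge0_pihalf// (ltW xpi) andbT; have := @pi_gt0 R; lra.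
have xs : x * cos x <= sin x by apply: mul_cos_le_sin; rewrite !ltW.
have -> : (sin x ^+ 2)^-1 = (cos x / sin x) ^+ 2 + 1.
  have <- : (cos x ^+ 2 + sin x ^+ 2) / sin x ^+ 2 = (sin x ^+ 2)^-1 by rewrite cos2Dsin2 mul1r.
  by field; rewrite gt_eqF.
rewrite lerD2r -exprVn ler_sqr ?nnegrE ?invr_ge0 ?(ltW x0) ?divr_ge0 ?(ltW s0)//.
by rewrite ler_pdivrMr// mulrC ler_pdivlMr// mulrC.
Qed.

Let odd_sum (n : nat) : R := \sum_(k < n) ((k.*2.+1)%:R ^+ 2)^-1.

(** Summing [inv_sin2_bounds] over the M nodes compares (16 M^2 / pi^2) [odd_sum M] with 2 M^2 up to
    an error M. After rescaling the error is pi^2 / (16 M), below 1 / M as pi < 4. *)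
Lemma odd_sum_bounds (j : nat) :
  `|odd_sum (2 ^ j) - pi ^+ 2 / 8| <= (2 ^ j)%:R^-1.
Proof.
set M := (2 ^ j)%N.
have M0 : (0 < M)%N by rewrite expn_gt0.
have M0' : 0 < M%:R :> R by rewrite ltr0n.
have pi0 := @pi_gt0 R.
have nodeE k : (node M k ^+ 2)^-1 = 16 * M%:R ^+ 2 / pi ^+ 2 * ((k.*2.+1)%:R ^+ 2)^-1.
  have aux (p m u : R) : p != 0 -> m != 0 -> u != 0 ->
      ((u * p / (4 * m)) ^+ 2)^-1 = 16 * m ^+ 2 / p ^+ 2 * (u ^+ 2)^-1.
    by move=> p0 m0 u0; field; rewrite p0 m0 u0.
  by apply: aux; rewrite ?pnatr_eq0// gt_eqF.
have sumE : \sum_(k < M) (sin (node M k) ^+ 2)^-1 = 2 * M%:R ^+ 2 := sum_inv_sin2 j.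
have lo : 16 * M%:R ^+ 2 / pi ^+ 2 * odd_sum M <= 2 * M%:R ^+ 2.
  rewrite -[leRHS]sumE mulr_sumr; apply: ler_sum => k _; rewrite -nodeE.
  by have /andP[] := inv_sin2_bounds (node_itv (ltn_ord k)).
have up : 2 * M%:R ^+ 2 <= 16 * M%:R ^+ 2 / pi ^+ 2 * odd_sum M + M%:R.
  rewrite -[leLHS]sumE.
  have M1 : \sum_(k < M) 1 = M%:R :> R by rewrite sumr_const card_ord.
  rewrite -[X in _ + X]M1 mulr_sumr -big_split /=; apply: ler_sum => k _; rewrite -nodeE.
  by have /andP[] := inv_sin2_bounds (node_itv (ltn_ord k)).
have c0 : 0 < pi ^+ 2 / (16 * M%:R ^+ 2) :> R by rewrite divr_gt0 ?mulr_gt0 ?exprn_gt0.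
have /(ler_wpM2l (ltW c0)) := lo; have /(ler_wpM2l (ltW c0)) := up.
have -> : pi ^+ 2 / (16 * M%:R ^+ 2) * (2 * M%:R ^+ 2) = pi ^+ 2 / 8 :> R.
  by move: pi M%:R M0' => p m m0; field; rewrite gt_eqF.
rewrite mulrDr.
have -> : pi ^+ 2 / (16 * M%:R ^+ 2) * (16 * M%:R ^+ 2 / pi ^+ 2 * odd_sum M) = odd_sum M.
  by move: pi pi0 M%:R M0' (odd_sum M) => p p0 m m0 s; field; rewrite !gt_eqF.
have -> : pi ^+ 2 / (16 * M%:R ^+ 2) * M%:R = (pi ^+ 2 / 16) * M%:R^-1 :> R.
  by move: pi M%:R M0' => p m m0; field; rewrite gt_eqF.
have : pi ^+ 2 / 16 * M%:R^-1 <= 1 * M%:R^-1 :> R.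
  apply: ler_wpM2r; first by rewrite invr_ge0 ltW.
  have := pi_lt4; nra.
have : 0 < M%:R^-1 :> R by rewrite invr_gt0.
by rewrite ler_norml; lra.
Qed.

Let zeta_sum (n : nat) : R := \sum_(k < n) (k.+1%:R ^+ 2)^-1.

Lemma sum_parity (F : nat -> R) (n : nat) :
  \sum_(k < n.*2) F k = \sum_(k < n) F k.*2 + \sum_(k < n) F k.*2.+1.
Proof.
elim: n => [|n IHn]; first by rewrite !big_ord0 addr0.
by rewrite doubleS !big_ord_recr /= IHn; ring.
Qed.

Lemma zeta_sum_even (n : nat) :
  \sum_(k < n) ((k.*2.+2)%:R ^+ 2)^-1 = zeta_sum n / 4.
Proof.
rewrite mulr_suml; apply: eq_bigr => k _.
have -> : (k.*2.+2 = k.+1 * 2)%N by lia.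
have : k.+1%:R != 0 :> R by rewrite pnatr_eq0.
by rewrite natrM; move: k.+1%:R => u u0; field.
Qed.

(** Splitting by parity gives z(2M) = [odd_sum M] + z(M) / 4, whose fixed point is pi^2 / 6. The
    constant 4 reproduces itself: 1 / M + (4 / M) / 4 = 4 / (2M). *)
Lemma zeta_sum_bounds (j : nat) :
  `|zeta_sum (2 ^ j) - pi ^+ 2 / 6| <= 4 / (2 ^ j)%:R.
Proof.
have pi0 := @pi_gt0 R; have pi4 := pi_lt4.
elim: j => [|j IHj].
  rewrite /zeta_sum big_ord_recl big_ord0 expr1n invr1 ler_norml; nra.
rewrite expnS mul2n.
have -> : zeta_sum (2 ^ j).*2 = odd_sum (2 ^ j) + zeta_sum (2 ^ j) / 4.
  by rewrite /zeta_sum (sum_parity (fun k => (k.+1%:R ^+ 2)^-1)) zeta_sum_even.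
have := odd_sum_bounds j; move: IHj; rewrite -muln2 natrM invfM mulrA.
set u := (2 ^ j)%:R^-1 : R.
by rewrite !ler_norml; lra.
Qed.

Lemma eta_sum_bounds (j : nat) :
  `|\sum_(k < (2 ^ j).*2) (-1) ^+ k * (k.+1%:R ^+ 2)^-1 - pi ^+ 2 / 12|
    <= 2 / (2 ^ j)%:R :> R.
Proof.
rewrite (sum_parity (fun k => (-1) ^+ k * (k.+1%:R ^+ 2)^-1)).
have -> : \sum_(k < 2 ^ j) (-1) ^+ k.*2 * ((k.*2.+1)%:R ^+ 2)^-1 = odd_sum (2 ^ j).
  by apply: eq_bigr => k _; rewrite -signr_odd odd_double mul1r.
have -> : \sum_(k < 2 ^ j) (-1) ^+ k.*2.+1 * ((k.*2.+2)%:R ^+ 2)^-1 = - (zeta_sum (2 ^ j) / 4).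
  rewrite -zeta_sum_even -sumrN; apply: eq_bigr => k _.
  by rewrite -signr_odd /= odd_double mulN1r.
have := odd_sum_bounds j; have := zeta_sum_bounds j.
set u := (2 ^ j)%:R^-1 : R.
by rewrite !ler_norml; lra.
Qed.

End Basel.

(** * Asymptotics of the saddle point data *)

Section LogSums.
Context {R : realType}.
Implicit Types (x y t : R).

(* In the terms of the proof idea, with [q = expR (- t)]: [2 * log_sum N t] is
   log P(q), while [2 * mean_sum N t] and [2 * var_sum N t] are the mean and the
   variance of the weighted sum of Bernoulli variables. *)
Definition log_sum (N : nat) t := \sum_(k < N) ln (1 + expR (- (k.+1%:R * t))).

Definition mean_sum (N : nat) t := \sum_(k < N) k.+1%:R / (expR (k.+1%:R * t) + 1).

Definition var_sum (N : nat) t :=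
  \sum_(k < N) k.+1%:R ^+ 2 * expR (k.+1%:R * t) / (expR (k.+1%:R * t) + 1) ^+ 2.

Lemma sum_geometric (N : nat) x : 0 < x ->
  \sum_(k < N) expR (- (k.+1%:R * x)) = (1 - expR (- (N%:R * x))) / (expR x - 1).
Proof.
move=> x0; have E0 := expR_sub1_gt0 x0.
elim: N => [|N IHN]; first by rewrite big_ord0 mul0r oppr0 expR0 subrr mul0r.
rewrite big_ord_recr /= IHN.
have -> : expR (- (N%:R * x)) = expR (- (N.+1%:R * x)) * expR x.
  by rewrite -expRD; congr expR; rewrite -natr1; ring.
by field; rewrite gt_eqF.
Qed.

Lemma inv_expR_sub1_le x : 0 < x -> (expR x - 1)^-1 <= x^-1.
Proof.
move=> x0; rewrite lef_pV2 ?posrE ?expR_sub1_gt0//.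
by have := expR_ge1Dx x; lra.
Qed.

Lemma expRN_le_inv x : 0 < x -> expR (- x) <= x^-1.
Proof.
move=> x0; rewrite expRN lef_pV2 ?posrE ?expR_gt0//.
by apply: le_trans (expR_ge1Dx x); rewrite lerDr.
Qed.

(** Each logarithm is expanded to order [M] and the sums are exchanged, so that the inner sums over
    [k] are geometric. The first error is the Taylor remainder, the second one the cut at [N] of the
    geometric sums. *)
Lemma log_sum_expansion (N M : nat) t : 0 < t ->
  `|log_sum N t - \sum_(i < M) (-1) ^+ i / i.+1%:R * (expR (i.+1%:R * t) - 1)^-1|
  <= (M.+1%:R ^+ 2 * t)^-1 + M%:R / t * expR (- (N%:R * t)).
Proof.
move=> t0.
pose g i := (1 - expR (- (N%:R * (i.+1%:R * t)))) / (expR (i.+1%:R * t) - 1) : R.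
have it0 i : 0 < i.+1%:R * t by rewrite mulr_gt0.
have gE i : \sum_(k < N) expR (- (k.+1%:R * t)) ^+ i.+1 = g i.
  rewrite /g -sum_geometric//; apply: eq_bigr => k _.
  by rewrite -expRM_natl; congr expR; ring.
have part1 : `|log_sum N t - \sum_(i < M) (-1) ^+ i / i.+1%:R * g i| <= (M.+1%:R ^+ 2 * t)^-1.
  have -> : \sum_(i < M) (-1) ^+ i / i.+1%:R * g i =
     \sum_(k < N) \sum_(i < M) (-1) ^+ i * expR (- (k.+1%:R * t)) ^+ i.+1 / i.+1%:R.
    rewrite exchange_big /=; apply: eq_bigr => i _.
    by rewrite -gE mulr_sumr; apply: eq_bigr => k _; rewrite mulrAC.
  rewrite /log_sum -sumrB; apply: le_trans (ler_norm_sum _ _ _) _.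
  apply: (@le_trans _ _ (\sum_(k < N) expR (- (k.+1%:R * t)) ^+ M.+1 / M.+1%:R)).
    by apply: ler_sum => k _; apply: ln1D_taylor; exact: expR_ge0.
  rewrite -mulr_suml gE /g expr2 -mulrA invfM mulrC.
  apply: ler_wpM2l; first by rewrite invr_ge0.
  apply: (@le_trans _ _ (1 / (expR (M.+1%:R * t) - 1))).
    apply: ler_wpM2r; first by rewrite invr_ge0 ltW// expR_sub1_gt0.
    by rewrite lerBlDr lerDl expR_ge0.
  by rewrite mul1r inv_expR_sub1_le.
have part2 : `|\sum_(i < M) (-1) ^+ i / i.+1%:R * g i -
    \sum_(i < M) (-1) ^+ i / i.+1%:R * (expR (i.+1%:R * t) - 1)^-1|
    <= M%:R / t * expR (- (N%:R * t)).
  rewrite -sumrB; apply: le_trans (ler_norm_sum _ _ _) _.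
  have -> : M%:R / t * expR (- (N%:R * t)) = \sum_(i < M) (t^-1 * expR (- (N%:R * t))).
    by rewrite sumr_const card_ord -[RHS]mulr_natl mulrA.
  apply: ler_sum => i _; rewrite -mulrBr /g.
  have -> : (1 - expR (- (N%:R * (i.+1%:R * t)))) / (expR (i.+1%:R * t) - 1)
      - (expR (i.+1%:R * t) - 1)^-1
    = - expR (- (N%:R * (i.+1%:R * t))) / (expR (i.+1%:R * t) - 1) by ring.
  rewrite !normrM normrN normr_sign mul1r (ger0_norm (expR_ge0 _)) !normfV.
  rewrite (ger0_norm (ltW (expR_sub1_gt0 (it0 i)))) ger0_norm//.
  have -> : i.+1%:R^-1 * (expR (- (N%:R * (i.+1%:R * t))) / (expR (i.+1%:R * t) - 1)) =
    (i.+1%:R^-1 / (expR (i.+1%:R * t) - 1)) * expR (- (N%:R * (i.+1%:R * t))) by ring.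
  have i1 : 1 <= i.+1%:R :> R by rewrite ler1n.
  apply: ler_pM; rewrite ?expR_ge0//.
  - by rewrite divr_ge0// ltW// expR_sub1_gt0.
  - rewrite -[leRHS]mul1r; apply: ler_pM; rewrite ?invr_ge0 ?invf_le1//.
      by rewrite ltW// expR_sub1_gt0.
    apply: le_trans (inv_expR_sub1_le (it0 i)) _.
    by rewrite lef_pV2 ?posrE// ler_peMl// ltW.
  - rewrite ler_expR lerN2; apply: ler_wpM2l => //.
    by rewrite ler_peMl// ltW.
exact: le_trans (ler_distD _ _ _) (lerD part1 part2).
Qed.

Lemma alternating_sum_bounds (f : nat -> R) (n : nat) :
  (forall i, 0 <= f i) -> (forall i, f i.+1 <= f i) ->
  0 <= \sum_(i < n.*2) (-1) ^+ i * f i <= f 0%N.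
Proof.
move=> f0 fS; suff : 0 <= \sum_(i < n.*2) (-1) ^+ i * f i <= f 0%N - f n.*2.
  by move=> /andP[-> h]; apply: le_trans h _; rewrite lerBlDr lerDl.
elim: n => [|n IHn]; first by rewrite big_ord0 subrr !lexx.
rewrite doubleS !big_ord_recr /= exprS -signr_odd odd_double expr0.
by have := fS n.*2; have := fS n.*2.+1; move: IHn; lra.
Qed.

Lemma log_sum_asymp t : 0 < t ->
  \forall N \near \oo, `|log_sum N t - (pi ^+ 2 / 12 / t - ln 2 / 2)| <= 2 * t.
Proof.
move=> t0.
(* With u the inverse of [2 ^ j], this bounds by t / 2 the errors 2 u / t for eta(2), u / t for the
   Taylor remainder and u for ln 2. Another t / 2 goes to the cut at [N], and t to the Bernoulli
   tails. *)
have [j jP] : exists j : nat, (3 / t + 1) / (t / 2) < (2 ^ j)%:R.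
  by exists (Num.bound ((3 / t + 1) / (t / 2))); rewrite natrX upper_nthrootP.
pose M := (2 ^ j).*2.
have M0 : 0 < (2 ^ j)%:R :> R by rewrite ltr0n expn_gt0.
near=> N.
have NM : M%:R / t * expR (- (N%:R * t)) <= t / 2.
  have N0 : (0 < N)%N by near: N; exists 1%N.
  have N0' : 0 < N%:R :> R by rewrite ltr0n.
  apply: (@le_trans _ _ (M%:R / t * (N%:R * t)^-1)).
    by apply: ler_wpM2l; [rewrite divr_ge0// ltW|rewrite expRN_le_inv// mulr_gt0].
  rewrite ler_pdivrMr ?mulr_gt0//.
  have : M%:R / t / (t / 2 * t) < N%:R.
    near: N; exists (Num.trunc (M%:R / t / (t / 2 * t))).+1 => // N /= NP.
    by apply: lt_le_trans (truncnS_gt _) _; rewrite ler_nat.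
  rewrite ltr_pdivrMr; last by rewrite !mulr_gt0// divr_gt0.
  by move/ltW/le_trans; apply; rewrite le_eqVlt; apply/orP; left; apply/eqP; ring.
have := @log_sum_expansion N M t t0.
(* The expansion of 1 / (exp x - 1) at x = (i + 1) t produces in turn the series of eta(2), that of
   ln 2 and an alternating sum of tails. *)
have termE i : (-1) ^+ i / i.+1%:R * (expR (i.+1%:R * t) - 1)^-1 =
    t^-1 * ((-1) ^+ i * (i.+1%:R ^+ 2)^-1) - 2^-1 * ((-1) ^+ i * 1 ^+ i.+1 / i.+1%:R)
    + t * ((-1) ^+ i * bernoulli_tail (i.+1%:R * t)) :> R.
  rewrite expr1n /bernoulli_tail; move: (expR (i.+1%:R * t) - 1)^-1 => u.
  have : i.+1%:R != 0 :> R by rewrite pnatr_eq0.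
  move: i.+1%:R => v v0; move: ((-1) ^+ i) => s.
  by field; rewrite v0 gt_eqF.
under eq_bigr do rewrite termE.
rewrite big_split /= sumrB -!mulr_sumr.
have := @eta_sum_bounds R j; rewrite -/M; set eta := \sum_(k < M) _.
have := @ln1D_taylor R M 1 ler01; rewrite expr1n; set L := \sum_(i < M) _.
have /= := @alternating_sum_bounds (fun i => bernoulli_tail (i.+1%:R * t)) (2 ^ j).
rewrite -/M; set G := \sum_(i < M) _ => HG.
have {HG}/andP[G0 G1] : 0 <= G <= 1.
  have it0 i : 0 < i.+1%:R * t by rewrite mulr_gt0.
  have /andP[-> h]: 0 <= G <= bernoulli_tail (1%:R * t).
    apply: HG => i; first exact: bernoulli_tail_ge0.
    by apply: bernoulli_tail_anti => //; rewrite ler_pM2r// ler_nat.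
  by apply: le_trans h _; apply: bernoulli_tail_le1; rewrite mul1r.
have MM : (2 ^ j)%:R <= M.+1%:R :> R by rewrite ler_nat /M -addnn; lia.
have MM1 : 1 <= M.+1%:R :> R by rewrite ler1n.
set u := (2 ^ j)%:R^-1 in jP *.
have inv1 : M.+1%:R^-1 <= u by rewrite lef_pV2 ?posrE.
have inv2 : (M.+1%:R ^+ 2 * t)^-1 <= u / t.
  rewrite invfM ler_pM2r ?invr_gt0//; apply: le_trans inv1.
  by rewrite lef_pV2 ?posrE ?exprn_gt0// expr2 ler_peMl.
have ut : u * (3 / t + 1) < t / 2.
  have -> : u * (3 / t + 1) = (3 / t + 1) / (2 ^ j)%:R by rewrite mulrC.
  by rewrite ltr_pdivrMr// [ltRHS]mulrC -ltr_pdivrMr// divr_gt0.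
have -> : (1 + 1 : R) = 2 by [].
have u0 : 0 < u by rewrite invr_gt0.
move=> hL heta hS.
have {heta}heta : `|t^-1 * eta - pi ^+ 2 / 12 / t| <= 2 * u / t.
  have -> : t^-1 * eta - pi ^+ 2 / 12 / t = (eta - pi ^+ 2 / 12) / t by ring.
  by rewrite normrM normfV (gtr0_norm t0) ler_pM2r ?invr_gt0.
have tG : 0 <= t * G <= t by rewrite mulr_ge0 ?(ltW t0)//= ler_piMr ?(ltW t0).
have ue : u * (3 / t + 1) = 3 * (u / t) + u by ring.
have ue2 : 2 * u / t = 2 * (u / t) by ring.
move: hL heta hS tG ut inv1 inv2 NM; rewrite ue ue2 mul1r.
move: (u / t) (M.+1%:R ^+ 2 * t)^-1 (M%:R / t * _) M.+1%:R^-1 (t^-1 * eta) (t * G).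
move: (log_sum N t) (pi ^+ 2 / 12 / t) (ln 2) => s w l q b c a v z.
rewrite !ler_norml => /andP[? ?] /andP[? ?] /andP[? ?] /andP[? ?] ? ? ? ?.
by apply/andP; split; lra.
Unshelve. all: by end_near.
Qed.

(** Convexity in tangent form. The ratio of 1 + e^(-(x+s)) to 1 + e^(-x) is the mean 1 - p + p
    e^(-s) for a Bernoulli variable, and Jensen's inequality [weighted] bounds it below by
    e^(-sp). *)
Lemma ln1D_tangent x s :
  ln (1 + expR (- x)) - s * (expR x + 1)^-1 <= ln (1 + expR (- (x + s))).
Proof.
have E0 := expR_gt0 x; have pos y : 0 < 1 + expR (- y) by rewrite ltr_wpDr ?expR_ge0.
pose p := (expR x + 1)^-1.
have p0 : 0 < p by rewrite invr_gt0 addr_gt0.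
have p1 : p <= 1 by rewrite invf_le1 ?addr_gt0// lerDr ltW.
have weighted : expR (- (s * p)) <= 1 - p + p * expR (- s).
  have -> : expR (- s) = expR (- (s * p)) * expR (- (s * (1 - p))).
    by rewrite -expRD; congr expR; ring.
  have -> : 1 - p + p * (expR (- (s * p)) * expR (- (s * (1 - p)))) =
     expR (- (s * p)) * ((1 - p) * expR (s * p) + p * expR (- (s * (1 - p)))).
    have := expRxMexpNx_1 (s * p); move: (expR (s * p)) (expR (- (s * p))) => a b ab.
    have -> : b * ((1 - p) * a + p * expR (- (s * (1 - p)))) =
       a * b * (1 - p) + p * (b * expR (- (s * (1 - p)))) by ring.
    by rewrite ab mul1r.
  rewrite ler_peMr ?expR_ge0//.
  have q0 : 0 <= 1 - p by rewrite subr_ge0.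
  have := ler_wpM2l q0 (expR_ge1Dx (s * p)).
  have := ler_wpM2l (ltW p0) (expR_ge1Dx (- (s * (1 - p)))).
  by lra.
have -> : 1 + expR (- (x + s)) = (1 + expR (- x)) * (1 - p + p * expR (- s)).
  rewrite opprD expRD /p (expRN x); field.
  by rewrite !gt_eqF ?addr_gt0.
rewrite lnM ?posrE//; last exact: lt_le_trans (expR_gt0 _) weighted.
by rewrite lerD2l -[leLHS]expRK ler_ln ?posrE ?expR_gt0//; exact: lt_le_trans (expR_gt0 _) weighted.
Qed.

(** Convexity of 1 / (e^x + 1), which holds on the positive axis only. With denominators cleared,
    the claim is affine in [expR x] with nonnegative slope by [key], so the smallest admissible
    value decides: 1 when s >= 0, [expR (- s)] when s <= 0. *)
Lemma invD1_tangent x s : 0 < x -> 0 < x + s ->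
  (expR x + 1)^-1 - s * (expR x / (expR x + 1) ^+ 2) <= (expR (x + s) + 1)^-1.
Proof.
move=> x0 xs0; have E0 := expR_gt0 x; have F0 := expR_gt0 s.
rewrite expRD -subr_ge0.
have -> : (expR x * expR s + 1)^-1 - ((expR x + 1)^-1 - s * (expR x / (expR x + 1) ^+ 2))
  = expR x * (s * (expR x * expR s + 1) - (expR s - 1) * (expR x + 1)) /
    ((expR x * expR s + 1) * (expR x + 1) ^+ 2).
  by field; rewrite !gt_eqF ?addr_gt0 ?mulr_gt0.
apply: divr_ge0; last by rewrite mulr_ge0 ?exprn_ge0 ?addr_ge0 ?mulr_ge0 ?ltW.
apply: mulr_ge0; first exact: ltW.
rewrite subr_ge0.
have key : expR s * (1 - s) <= 1.
  have := ler_wpM2l (ltW F0) (expR_ge1Dx (- s)); rewrite expRxMexpNx_1; lra.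
have [s0|/ltW s0] := leP 0 s.
  have E1 : 1 <= expR x by rewrite -expR0 ler_expR ltW.
  have := expR_tanh_le s0; nra.
have E1 : 1 <= expR x * expR s by rewrite -expRD -expR0 ler_expR ltW.
have /expR_sinh_ge : 0 <= - s by rewrite oppr_ge0.
rewrite opprK => sh.
have := expRxMexpNx_1 s; move: sh key E1 F0 E0.
move: (expR s) (expR (- s)) (expR x) => F F' E sh key E1 F0 E0 FF.
have EF : F' <= E by nra.
by nra.
Qed.

Lemma log_sum_tangent (N : nat) t h :
  log_sum N t - h * mean_sum N t <= log_sum N (t + h).
Proof.
rewrite /log_sum /mean_sum mulr_sumr -sumrB; apply: ler_sum => k _.
by rewrite mulrDr mulrA (mulrC h); exact: ln1D_tangent.
Qed.

Lemma mean_sum_tangent (N : nat) t h : 0 < t -> 0 < t + h ->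
  mean_sum N t - h * var_sum N t <= mean_sum N (t + h).
Proof.
move=> t0 th0; rewrite /mean_sum /var_sum mulr_sumr -sumrB; apply: ler_sum => k _.
have -> : h * (k.+1%:R ^+ 2 * expR (k.+1%:R * t) / (expR (k.+1%:R * t) + 1) ^+ 2) =
  k.+1%:R * (k.+1%:R * h * (expR (k.+1%:R * t) / (expR (k.+1%:R * t) + 1) ^+ 2)) by ring.
rewrite -mulrBr; apply: ler_wpM2l => //.
by rewrite mulrDr; apply: invD1_tangent; rewrite -?mulrDr mulr_gt0.
Qed.

Lemma pi2_12_bounds : 0 < (pi : R) ^+ 2 / 12 <= 4 / 3.
Proof. by have := @pi_lt4 R; have := @pi_gt0 R; nra. Qed.

(* The asymptotics of [log_sum N] can be differentiated because this function is
   convex with derivative [- mean_sum N]; the step [h] balances the errors. *)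
Lemma mean_sum_asymp t : 0 < t -> t <= 1 / 2 ->
  \forall N \near \oo, `|mean_sum N t - pi ^+ 2 / 12 / t ^+ 2| <= 7 / t.
Proof.
move=> t0 t2; pose h := t ^+ 2.
have h0 : 0 < h by rewrite exprn_gt0.
have th0 : 0 < t + h by rewrite addr_gt0.
have ht0 : 0 < t + - h by rewrite /h; nra.
move: (log_sum_asymp t0) (log_sum_asymp th0) (log_sum_asymp ht0).
apply: filterS3 => N.
have := log_sum_tangent N t h; have := log_sum_tangent N t (- h).
have /andP[] := pi2_12_bounds; move: (pi ^+ 2 / 12) => A A0 A1.
move: (log_sum N t) (log_sum N (t + h)) (log_sum N (t - h)) (mean_sum N t) (ln 2 / 2).
move=> S Sp Sm m B Tm Tp; rewrite !ler_norml => /andP[l1 u1] /andP[l2 u2] /andP[l3 u3].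
have m_ge : A / t - A / (t + h) - (4 * t + 2 * h) <= h * m by lra.
have m_le : h * m <= A / (t - h) - A / t + 4 * t by lra.
have tn0 : t != 0 by rewrite gt_eqF.
have e1 : A / t - A / (t + h) = h * (A / t ^+ 2 - A / t + A / (1 + t)).
  by rewrite /h; field; rewrite tn0 !gt_eqF//; nra.
have e2 : A / (t - h) - A / t = h * (A / t ^+ 2 + A / t + A / (1 - t)).
  by rewrite /h; field; rewrite tn0 !gt_eqF//; nra.
have A2 : A / (1 - t) <= 2 * A.
  by rewrite ler_pdivrMr; clear -t0 t2 A0; nra.
have A3 : 0 <= A / (1 + t) by rewrite divr_ge0; clear -t0 A0; lra.
have ti : 2 <= t^-1 by rewrite -[leLHS]invrK lef_pV2 ?posrE//; clear -t0 t2; lra.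
have At : A / t <= 4 / 3 * t^-1 by apply: ler_wpM2r => //; rewrite invr_ge0 ltW.
have hti : h * t^-1 = t by rewrite /h; field.
have ht : h <= t / 2 by rewrite /h; clear -t0 t2; nra.
have hA := ler_wpM2l (ltW h0) At; have hA2 := ler_wpM2l (ltW h0) A2.
have hA3 := mulr_ge0 (ltW h0) A3.
have hA1 := ler_wpM2l (ltW h0) A1.
rewrite e1 in m_ge; rewrite e2 in m_le.
move: hti m_ge m_le hA hA2 hA3 hA1.
move: (A / t ^+ 2) (A / t) (A / (1 + t)) (A / (1 - t)) t^-1 => P Q V W ti'.
move=> hti m_ge m_le hA hA2 hA3 hA1.
by apply/andP; split; rewrite -(ler_pM2l h0); clear -hti ht m_ge m_le hA hA2 hA3 hA1; nra.
Qed.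

(** The convexity argument again, now for [mean_sum N]. Errors of order 1 / t in its values and a
    curvature of order t^(-4) balance at the step t^(3/2), which leaves t^(-5/2). *)
Lemma var_sum_asymp t : 0 < t -> t <= 1 / 16 ->
  \forall N \near \oo, `|var_sum N t - 2 * (pi ^+ 2 / 12) / t ^+ 3| <= 28 * Num.sqrt t / t ^+ 3.
Proof.
move=> t0 t16; pose s := Num.sqrt t.
have s0 : 0 < s by rewrite sqrtr_gt0.
have ts : t = s ^+ 2 by rewrite sqr_sqrtr// ltW.
have s4 : s <= 1 / 4 by nra.
pose h := t * s.
have h0 : 0 < h by rewrite mulr_gt0.
have th0 : 0 < t + h by rewrite addr_gt0.
have ht0 : 0 < t - h by rewrite /h; nra.
move: (@mean_sum_asymp t t0) (mean_sum_asymp th0) (mean_sum_asymp ht0).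
move=> /(_ ltac:(lra)) + /(_ ltac:(rewrite /h; nra)) + /(_ ltac:(rewrite /h; nra)).
apply: filterS3 => N.
have := mean_sum_tangent N t0 th0; have := mean_sum_tangent N t0 ht0.
have /andP[] := pi2_12_bounds; move: (pi ^+ 2 / 12) => A A0 A1.
move: (mean_sum N t) (mean_sum N (t + h)) (mean_sum N (t - h)) (var_sum N t).
move=> S Sp Sm m Tm Tp; rewrite !ler_norml => /andP[l1 u1] /andP[l2 u2] /andP[l3 u3].
have m_ge : A / t ^+ 2 - A / (t + h) ^+ 2 - 7 / t - 7 / (t + h) <= h * m by lra.
have m_le : h * m <= A / (t - h) ^+ 2 - A / t ^+ 2 + 7 / t + 7 / (t - h) by lra.
have sn0 : s != 0 by rewrite gt_eqF.
have tp0 : 1 + s != 0 by rewrite gt_eqF//; clear -s0; lra.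
have tm0 : 1 - s != 0 by rewrite gt_eqF//; clear -s4; lra.
have c0 : 0 < h / t ^+ 3 by rewrite divr_gt0 ?exprn_gt0.
have e1 : A / t ^+ 2 - A / (t + h) ^+ 2 - 7 / t - 7 / (t + h) =
    h / t ^+ 3 * (A * (2 + s) / (1 + s) ^+ 2 - 7 * s - 7 * s / (1 + s)).
  have -> : t + h = s ^+ 2 * (1 + s) by rewrite /h ts; ring.
  by rewrite /h ts; field; rewrite sn0 tp0.
have e2 : A / (t - h) ^+ 2 - A / t ^+ 2 + 7 / t + 7 / (t - h) =
    h / t ^+ 3 * (A * (2 - s) / (1 - s) ^+ 2 + 7 * s + 7 * s / (1 - s)).
  have -> : t - h = s ^+ 2 * (1 - s) by rewrite /h ts; ring.
  by rewrite /h ts; field; rewrite sn0 tm0.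
have b1 : A * (2 - 4 * s) <= A * (2 + s) / (1 + s) ^+ 2.
  rewrite ler_pdivlMr; last by rewrite exprn_gt0//; clear -s0; lra.
  by rewrite -mulrA ler_pM2l//; clear -s0 s4; nra.
have b2 : A * (2 - s) / (1 - s) ^+ 2 <= A * (2 + 8 * s).
  rewrite ler_pdivrMr; last by rewrite exprn_gt0//; clear -s4; lra.
  by rewrite -mulrA ler_pM2l//; clear -s0 s4; nra.
have b3 : 7 * s / (1 + s) <= 7 * s by rewrite ler_pdivrMr; clear -s0; nra.
have b4 : 7 * s / (1 - s) <= 10 * s by rewrite ler_pdivrMr; clear -s0 s4; nra.
set c := h / t ^+ 3 in c0 e1 e2.
have hm : h * (m - 2 * A / t ^+ 3) = h * m - c * (2 * A) by rewrite /c; ring.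
apply/andP; split; rewrite -(ler_pM2l h0) hm.
- have -> : h * - (28 * Num.sqrt t / t ^+ 3) = c * (- (28 * s)) by rewrite /c -/s; ring.
  have := ler_wpM2l (ltW c0)
    (_ : - (28 * s) + 2 * A <= A * (2 + s) / (1 + s) ^+ 2 - 7 * s - 7 * s / (1 + s)).
  rewrite -e1 => /(_ ltac:(clear -b1 b3 A0 A1 s0; nra)).
  by clear -m_ge; lra.
- have -> : h * (28 * Num.sqrt t / t ^+ 3) = c * (28 * s) by rewrite /c -/s; ring.
  have := ler_wpM2l (ltW c0)
    (_ : A * (2 - s) / (1 - s) ^+ 2 + 7 * s + 7 * s / (1 - s) <= 28 * s + 2 * A).
  rewrite -e2 => /(_ ltac:(clear -b2 b4 A0 A1 s0; nra)).
  by clear -m_le; lra.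
Qed.

End LogSums.

(** * Characteristic functions of Bernoulli variables *)

Section CharacteristicFunction.
Context {R : realType}.
Implicit Types (x y t p : R).

Local Notation normc := (@Normc.normc R).

Definition cis x : R[i] := Complex (cos x) (sin x).

Lemma cisD x y : cis (x + y) = cis x * cis y.
Proof. by rewrite /cis cosD sinD; congr Complex; rewrite addrC (mulrC (sin x)). Qed.

Lemma cis0 : cis 0 = 1.
Proof. by rewrite /cis cos0 sin0. Qed.

Lemma cisMn (n : nat) x : cis (n%:R * x) = cis x ^+ n.
Proof.
elim: n => [|n IHn]; first by rewrite mul0r cis0 expr0.
by rewrite -natr1 mulrDl mul1r cisD IHn exprSr.
Qed.

Lemma cis_sum (I : Type) (s : seq I) (F : I -> R) :
  cis (\sum_(i <- s) F i) = \prod_(i <- s) cis (F i).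
Proof. by apply: (big_morph cis); [exact: cisD|exact: cis0]. Qed.

Lemma normc_cis x : normc (cis x) = 1.
Proof. by rewrite /= cos2Dsin2 sqrtr1. Qed.

Lemma normc_prod (I : Type) (s : seq I) (F : I -> R[i]) :
  normc (\prod_(i <- s) F i) = \prod_(i <- s) normc (F i).
Proof. by apply: (big_morph normc); [exact: Normc.normcM|exact: Normc.normc1]. Qed.

Lemma normc_le_ReIm (z : R[i]) : normc z <= `|complex.Re z| + `|complex.Im z|.
Proof.
case: z => a b /=; rewrite -[leRHS]ger0_norm ?addr_ge0// -sqrtr_sqr ler_wsqrtr//.
rewrite sqrrD !real_normK ?num_real// -addrA lerD2l lerDr.
by rewrite mulrn_wge0// mulr_ge0.
Qed.

Lemma Re_le_normc (z : R[i]) : `|complex.Re z| <= normc z.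
Proof. by case: z => a b /=; rewrite -sqrtr_sqr ler_wsqrtr// lerDl sqr_ge0. Qed.

Lemma normc_ge0 (z : R[i]) : 0 <= normc z.
Proof. by case: z => a b /=; exact: sqrtr_ge0. Qed.

(** The factors are exchanged one at a time, while all others have modulus at most 1. *)
Lemma normc_sub_prod (n : nat) (a b : nat -> R[i]) :
  (forall i, normc (a i) <= 1) -> (forall i, normc (b i) <= 1) ->
  normc (\prod_(i < n) a i - \prod_(i < n) b i) <= \sum_(i < n) normc (a i - b i).
Proof.
move=> a1 b1; elim: n => [|n IHn]; first by rewrite !big_ord0 subrr Normc.normc0.
rewrite !big_ord_recr /=; set Pa := \prod_(i < n) a i; set Pb := \prod_(i < n) b i.
have -> : Pa * a n - Pb * b n = (Pa - Pb) * a n + Pb * (a n - b n) by ring.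
apply: le_trans (le_normcD _ _) _; rewrite !Normc.normcM; apply: lerD.
  by apply: le_trans IHn; rewrite ler_piMr// normc_ge0.
rewrite ler_piMl ?normc_ge0// /Pb normc_prod.
by apply: prodr_ile1 => i _; rewrite normc_ge0 b1.
Qed.

(* The characteristic function of a Bernoulli variable of parameter [p]. *)
Definition bernoulli_cf p x : R[i] := Complex (1 - p + p * cos x) (p * sin x).

Lemma normc_bernoulli_cf p x :
  normc (bernoulli_cf p x) ^+ 2 = 1 - 2 * (p * (1 - p)) * (1 - cos x).
Proof.
rewrite /= sqr_sqrtr ?addr_ge0 ?sqr_ge0//.
have -> : (1 - p + p * cos x) ^+ 2 + (p * sin x) ^+ 2 =
  (1 - p) ^+ 2 + 2 * p * (1 - p) * cos x + p ^+ 2 * (cos x ^+ 2 + sin x ^+ 2) by ring.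
by rewrite cos2Dsin2; ring.
Qed.

Lemma normc_bernoulli_cf_le1 p x : 0 <= p <= 1 -> normc (bernoulli_cf p x) <= 1.
Proof.
move=> /andP[p0 p1]; rewrite -(@expr_le1 _ 2)// ?normc_ge0// normc_bernoulli_cf.
by rewrite gerBl !mulr_ge0// subr_ge0// cos_le1.
Qed.

(** The factor [cis (- (p * x))] centres the variable: it takes the value q = 1 - p with probability
    p and -p with probability q, so the linear terms cancel. The factor p in the bound makes the
    errors summable over the parts. *)
Lemma bernoulli_cf_gauss p x : 0 <= p <= 1 ->
  normc (bernoulli_cf p x * cis (- (p * x)) - (expR (- (p * (1 - p) * x ^+ 2 / 2)))%:C%C)
    <= p * (x ^+ 4 + `|x| ^+ 3).
Proof.
move=> /andP[p0 p1]; set q := 1 - p; have q0 : 0 <= q by rewrite subr_ge0.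
set e := expR _.
have -> : bernoulli_cf p x * cis (- (p * x)) - e%:C%C =
    Complex (q * cos (p * x) + p * cos (q * x) - e) (p * sin (q * x) - q * sin (p * x)).
  rewrite /bernoulli_cf /cis /=; have -> : x = p * x + q * x by rewrite /q; ring.
  rewrite -/q.
  have -> : p * (p * x + q * x) = p * x by rewrite /q; ring.
  have -> : q * (p * x + q * x) = q * x by rewrite /q; ring.
  rewrite cosN sinN cosD sinD; have cs := cos2Dsin2 (p * x).
  apply/eqP; rewrite eq_complex /=; apply/andP; split; apply/eqP.
    have RE (c s u v : R) : c ^+ 2 + s ^+ 2 = 1 ->
        (q + p * (c * u - s * v)) * c - p * (s * u + c * v) * - s - e = q * c + p * u - e.
      move=> cs1; have -> : q * c + p * u - e = q * c + p * ((c ^+ 2 + s ^+ 2) * u) - e.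
        by rewrite cs1 mul1r.
      ring.
    by rewrite -(RE _ (sin (p * x)) _ (sin (q * x)))//; ring.
  have IE (c s u v : R) : c ^+ 2 + s ^+ 2 = 1 ->
      (q + p * (c * u - s * v)) * - s + p * (s * u + c * v) * c = p * v - q * s.
    move=> cs1; have -> : p * v - q * s = p * ((c ^+ 2 + s ^+ 2) * v) - q * s.
      by rewrite cs1 mul1r.
    ring.
  by rewrite -(IE (cos (p * x)) _ (cos (q * x)))//; ring.
apply: le_trans (normc_le_ReIm _) _; rewrite /= mulrDr.
have q1 : q <= 1 by rewrite gerBl.
have powB (u : R) (n : nat) : 0 <= u <= 1 -> 0 <= u ^+ n <= 1.
  by move=> /andP[u0 u1]; rewrite exprn_ge0// exprn_ile1.
have x4 : 0 <= x ^+ 4 by rewrite exprn_even_ge0.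
have x3 : 0 <= `|x| ^+ 3 by rewrite exprn_ge0.
have px4 : 0 <= p * x ^+ 4 by rewrite mulr_ge0.
have px3 : 0 <= p * `|x| ^+ 3 by rewrite mulr_ge0.
apply: lerD.
- set v := p * q * x ^+ 2 / 2.
  have v0 : 0 <= v by rewrite /v divr_ge0// mulr_ge0 ?sqr_ge0// mulr_ge0.
  have he := expR_taylor2 v0; rewrite -/e in he.
  have := cos_taylor4 (p * x); have := cos_taylor4 (q * x); rewrite !exprMn => hq hp.
  (* The quadratic terms match because q p^2 + p q^2 = p q. *)
  have -> : q * cos (p * x) + p * cos (q * x) - e =
     q * (cos (p * x) - (1 - p ^+ 2 * x ^+ 2 / 2)) + p * (cos (q * x) - (1 - q ^+ 2 * x ^+ 2 / 2))
     - (e - (1 - v)).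
    by rewrite /v /q; field.
  have {}hp : `|q * (cos (p * x) - (1 - p ^+ 2 * x ^+ 2 / 2))| <= p * x ^+ 4 / 24.
    rewrite normrM (ger0_norm q0); apply: le_trans (ler_wpM2l q0 hp) _.
    have /andP[p30 p31] := powB p 3 ltac:(by rewrite p0).
    have -> : q * (p ^+ 4 * x ^+ 4 / 24) = (q * p ^+ 3) * (p * x ^+ 4 / 24) by ring.
    rewrite -[leRHS]mul1r; apply: ler_wpM2r; first by rewrite divr_ge0.
    by rewrite mulr_ile1.
  have {}hq : `|p * (cos (q * x) - (1 - q ^+ 2 * x ^+ 2 / 2))| <= p * x ^+ 4 / 24.
    rewrite normrM (ger0_norm p0); apply: le_trans (ler_wpM2l p0 hq) _.
    have /andP[p30 p31] := powB q 4 ltac:(by rewrite q0).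
    have -> : p * (q ^+ 4 * x ^+ 4 / 24) = q ^+ 4 * (p * x ^+ 4 / 24) by ring.
    by rewrite -[leRHS]mul1r; apply: ler_wpM2r => //; rewrite divr_ge0.
  have {}he : `|e - (1 - v)| <= p * x ^+ 4 / 8.
    apply: le_trans he _.
    have -> : v ^+ 2 / 2 = (p * q ^+ 2) * (p * x ^+ 4 / 8) by rewrite /v; field.
    have /andP[p30 p31] := powB q 2 ltac:(by rewrite q0).
    rewrite -[leRHS]mul1r; apply: ler_wpM2r; first by rewrite divr_ge0.
    by rewrite mulr_ile1.
  by move: hp hq he; rewrite !ler_norml; lra.
- have := sin_taylor3 (p * x); have := sin_taylor3 (q * x).
  rewrite !normrM (ger0_norm p0) (ger0_norm q0) !exprMn => hq hp.
  have -> : p * sin (q * x) - q * sin (p * x) =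
    p * (sin (q * x) - q * x) - q * (sin (p * x) - p * x) by ring.
  have {}hp : `|q * (sin (p * x) - p * x)| <= p * `|x| ^+ 3 / 6.
    rewrite normrM (ger0_norm q0); apply: le_trans (ler_wpM2l q0 hp) _.
    have /andP[p30 p31] := powB p 2 ltac:(by rewrite p0).
    have -> : q * (p ^+ 3 * `|x| ^+ 3 / 6) = (q * p ^+ 2) * (p * `|x| ^+ 3 / 6) by ring.
    rewrite -[leRHS]mul1r; apply: ler_wpM2r; first by rewrite divr_ge0.
    by rewrite mulr_ile1.
  have {}hq : `|p * (sin (q * x) - q * x)| <= p * `|x| ^+ 3 / 6.
    rewrite normrM (ger0_norm p0); apply: le_trans (ler_wpM2l p0 hq) _.
    have /andP[p30 p31] := powB q 3 ltac:(by rewrite q0).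
    have -> : p * (q ^+ 3 * `|x| ^+ 3 / 6) = q ^+ 3 * (p * `|x| ^+ 3 / 6) by ring.
    by rewrite -[leRHS]mul1r; apply: ler_wpM2r => //; rewrite divr_ge0.
  by move: hp hq; rewrite !ler_norml; lra.
Qed.

End CharacteristicFunction.

(** * Gaussian approximation and decay of the characteristic function *)

Section LocalLimit.
Context {R : realType}.
Implicit Types (x y t p th : R).

Local Notation normc := (@Normc.normc R).

(** The probability q^k / (1 + q^k), shifted to index [k.+1], that a part is chosen when the factor
    1 + q^k is normalised. *)
Definition fermi t (k : nat) : R := (expR (k.+1%:R * t) + 1)^-1.

Lemma fermi_itv t k : 0 <= fermi t k <= 1.
Proof.
by rewrite /fermi invr_ge0 addr_ge0 ?expR_ge0//= invf_le1 ?ltr_wpDl ?lerDr ?expR_ge0.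
Qed.

Lemma fermi_le t k : fermi t k <= expR (- (k.+1%:R * t)).
Proof. by rewrite expRN lef_pV2 ?posrE ?addr_gt0 ?expR_gt0// lerDl. Qed.

Definition char_fun (N : nat) t th : R[i] :=
  \prod_(k < N) bernoulli_cf (fermi t k) (k.+1%:R * th) ^+ 2.

(** Recentred at [n] instead of the mean, so that its integral over a period isolates the
    coefficient of index [n]. *)
Definition recentred_char_fun (N : nat) t (n : nat) th : R :=
  complex.Re (char_fun N t th * cis (- (n%:R * th))).

(** Half of the exponential absorbs the power through y^a <= a! e^y; the other half sums as a
    geometric series. *)
Lemma moment_bound (N a : nat) t : 0 < t ->
  \sum_(k < N) k.+1%:R ^+ a * expR (- (k.+1%:R * t)) <= a`!%:R * (2 / t) ^+ a.+1.
Proof.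
move=> t0; have t20 : 0 < t / 2 by rewrite divr_gt0.
apply: (@le_trans _ _ (\sum_(k < N) a`!%:R * (2 / t) ^+ a * expR (- (k.+1%:R * (t / 2))))).
  apply: ler_sum => k _.
  have m0 : 0 <= k.+1%:R * (t / 2) by rewrite mulr_ge0// ltW.
  have -> : k.+1%:R ^+ a = (2 / t) ^+ a * (k.+1%:R * (t / 2)) ^+ a.
    by rewrite -exprMn; congr (_ ^+ a); field; rewrite gt_eqF.
  have -> : - (k.+1%:R * t) = - (k.+1%:R * (t / 2)) - k.+1%:R * (t / 2) by field.
  have := ler_wpM2r (expR_ge0 (- (k.+1%:R * (t / 2)))) (exprn_le_expR a m0).
  rewrite -[leRHS]mulrA expRxMexpNx_1 mulr1 => h.
  rewrite expRD mulrA; apply: ler_wpM2r; first exact: expR_ge0.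
  rewrite -mulrA [leRHS]mulrC; apply: ler_wpM2l => //.
  by rewrite exprn_ge0// divr_ge0// ltW.
rewrite -mulr_sumr exprSr mulrA; apply: ler_wpM2l.
  by rewrite mulr_ge0// exprn_ge0// divr_ge0// ltW.
rewrite sum_geometric//; apply: (@le_trans _ _ (1 / (expR (t / 2) - 1))).
  apply: ler_wpM2r; first by rewrite invr_ge0 ltW// expR_sub1_gt0.
  by rewrite lerBlDr lerDl expR_ge0.
by rewrite mul1r -[2 / t]invf_div inv_expR_sub1_le.
Qed.

Lemma normc_cis_sub1 x : normc (cis x - 1) <= x ^+ 2 / 2 + `|x|.
Proof.
apply: le_trans (normc_le_ReIm _) _; rewrite /= subr0; apply: lerD.
  rewrite -cos_norm distrC ger0_norm ?subr_ge0 ?cos_le1//.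
  have := cos_ge2 (normr_ge0 x); rewrite real_normK ?num_real//; lra.
have [x0|x0] := leP 0 x.
  have := sin_le x0; rewrite (ger0_norm x0) ler_norml => ->; rewrite andbT.
  have [x2|x2] := leP x 2; first by rewrite (le_trans _ (sin_ge_third _)) ?x0//; lra.
  by have := sin_geN1 x; lra.
have x0' : 0 <= - x by rewrite oppr_ge0 ltW.
have := sin_le x0'; rewrite sinN (ltr0_norm x0) ler_norml opprK => h.
apply/andP; split; first lra.
have [x2|x2] := leP (- x) 2.
  by have := @sin_ge_third _ (- x); rewrite sinN x0' x2 => /(_ isT); lra.
by have := sin_le1 x; lra.
Qed.

(** Here [d] is the phase left by the mismatch of the mean and [n]. The constants come from
    [moment_bound], doubled because P(q) is a square: 1536 = 2 * 4! * 2^5 and 192 = 2 * 3! * 2^4. *)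
Lemma recentred_char_fun_gauss (N n : nat) t th d :
  0 < t -> d = (2 * mean_sum N t - n%:R) * th ->
  `|recentred_char_fun N t n th - expR (- (var_sum N t * th ^+ 2))| <=
    1536 * th ^+ 4 / t ^+ 5 + 192 * `|th| ^+ 3 / t ^+ 4 + (d ^+ 2 / 2 + `|d|).
Proof.
move=> t0 dE.
pose v k := bernoulli_cf (fermi t k) (k.+1%:R * th) * cis (- (fermi t k * (k.+1%:R * th))).
pose e k : R := expR (- (fermi t k * (1 - fermi t k) * (k.+1%:R * th) ^+ 2 / 2)).
have v1 k : normc (v k) <= 1.
  by rewrite Normc.normcM normc_cis mulr1 normc_bernoulli_cf_le1// fermi_itv.
have eq0 k : 0 <= fermi t k * (1 - fermi t k).
  by have /andP[f0 f1] := fermi_itv t k; rewrite mulr_ge0// subr_ge0.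
have normcR (r : R) : 0 <= r -> normc r%:C%C = r.
  by move=> r0; rewrite /= expr0n /= addr0 sqrtr_sqr ger0_norm.
have e1 k : normc (e k)%:C%C <= 1.
  rewrite normcR ?expR_ge0// -expR0 ler_expR oppr_le0 divr_ge0// mulr_ge0// sqr_ge0//.
set V := \prod_(k < N) v k; set E := \prod_(k < N) (e k)%:C%C : R[i].
have charE : char_fun N t th * cis (- (n%:R * th)) = V ^+ 2 * cis d.
  have -> : cis d = cis (\sum_(k < N) fermi t k * (k.+1%:R * th)) ^+ 2 * cis (- (n%:R * th)).
    rewrite -cisMn -cisD; congr cis; rewrite dE mulrBl; congr (_ - _).
    rewrite /mean_sum -mulrA mulr_suml mulr_sumr mulr_sumr; apply: eq_bigr => k _.
    by rewrite /fermi; ring.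
  rewrite mulrA cis_sum -exprMn -big_split /= -prodrXl; congr (_ * _); apply: eq_bigr => k _.
  by rewrite /v -mulrA -cisD addNr cis0 mulr1.
have EE : E ^+ 2 = (expR (- (var_sum N t * th ^+ 2)))%:C%C.
  rewrite /E -rmorph_prod -rmorphXn /=; congr (real_complex _ _).
  rewrite /e -expR_sum -expRM_natl; congr expR.
  rewrite /var_sum mulr_suml -sumrN mulr_sumr; apply: eq_bigr => k _.
  rewrite /fermi; have : expR (k.+1%:R * t) + 1 != 0 by rewrite gt_eqF// addr_gt0// expR_gt0.
  by move: (expR _) => u u0; field.
have E1 : normc E <= 1.
  by rewrite normc_prod; apply: prodr_ile1 => k _; rewrite normc_ge0 e1.
have V1 : normc V <= 1.
  by rewrite normc_prod; apply: prodr_ile1 => k _; rewrite normc_ge0 v1.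
have ReE : recentred_char_fun N t n th - expR (- (var_sum N t * th ^+ 2)) =
    complex.Re (V ^+ 2 * cis d - E ^+ 2).
  by rewrite /recentred_char_fun charE EE raddfB.
rewrite ReE; apply: le_trans (Re_le_normc _) _.
have -> : V ^+ 2 * cis d - E ^+ 2 = (V - E) * ((V + E) * cis d) + E ^+ 2 * (cis d - 1) by ring.
apply: le_trans (le_normcD _ _) _; apply: lerD; last first.
  rewrite Normc.normcM; apply: le_trans (normc_cis_sub1 d).
  by rewrite ler_piMl ?normc_ge0// expr2 Normc.normcM mulr_ile1 ?normc_ge0.
rewrite !Normc.normcM normc_cis mulr1.
apply: (@le_trans _ _ ((\sum_(k < N) expR (- (k.+1%:R * t)) *
    ((k.+1%:R * th) ^+ 4 + `|k.+1%:R * th| ^+ 3)) * 2)).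
  apply: ler_pM; rewrite ?normc_ge0//; last first.
    by apply: le_trans (le_normcD _ _) _; lra.
  apply: le_trans (normc_sub_prod N v1 e1) _; apply: ler_sum => k _.
  apply: le_trans (bernoulli_cf_gauss _ (fermi_itv t k)) _.
  apply: ler_wpM2r (fermi_le t k).
  by apply: addr_ge0; [rewrite exprn_even_ge0|rewrite exprn_ge0].
have -> : \sum_(k < N) expR (- (k.+1%:R * t)) * ((k.+1%:R * th) ^+ 4 + `|k.+1%:R * th| ^+ 3)
  = th ^+ 4 * (\sum_(k < N) k.+1%:R ^+ 4 * expR (- (k.+1%:R * t)))
  + `|th| ^+ 3 * (\sum_(k < N) k.+1%:R ^+ 3 * expR (- (k.+1%:R * t))).
  rewrite !mulr_sumr -big_split /=; apply: eq_bigr => k _.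
  by rewrite normrM ger0_norm//; ring.
have m4 := moment_bound N 4 t0; have m3 := moment_bound N 3 t0.
have th4 : 0 <= th ^+ 4 by rewrite exprn_even_ge0.
have th3 : 0 <= `|th| ^+ 3 by rewrite exprn_ge0.
have := ler_wpM2l th4 m4; have := ler_wpM2l th3 m3.
have -> : th ^+ 4 * (4`!%:R * (2 / t) ^+ 5) = 768 * th ^+ 4 / t ^+ 5.
  by rewrite (_ : 4`! = 24)%N//; field; rewrite gt_eqF.
have -> : `|th| ^+ 3 * (3`!%:R * (2 / t) ^+ 4) = 96 * `|th| ^+ 3 / t ^+ 4.
  by rewrite (_ : 3`! = 6)%N//; field; rewrite gt_eqF.
by lra.
Qed.

(** Each squared modulus 1 - 2 p (1 - p) (1 - cos) is at most an exponential, and 2 p (1 - p) >=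
    e^(-y) / 2 because (E + 1)^2 <= 4 E^2 for E = e^y >= 1. *)
Lemma normc_char_fun_le (N : nat) t th : 0 <= t ->
  normc (char_fun N t th) <=
  expR (- (\sum_(k < N) expR (- (k.+1%:R * t)) * (1 - cos (k.+1%:R * th)) / 2)).
Proof.
move=> t0; rewrite normc_prod -sumrN expR_sum; apply: ler_prod => k _.
rewrite normc_ge0 expr2 Normc.normcM -expr2 normc_bernoulli_cf.
apply: le_trans (expR_ge1Dx _); rewrite lerD2l lerN2.
set u := 1 - cos _; have u0 : 0 <= u by rewrite subr_ge0 cos_le1.
rewrite mulrAC; apply: ler_wpM2r => //.
rewrite /fermi expRN; have := expR_ge1Dx (k.+1%:R * t).
have : 0 <= k.+1%:R * t by rewrite mulr_ge0.
move: (k.+1%:R * t) => y y0 yE; move: (expR y) yE => E yE.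
have E1 : 1 <= E by lra.
have -> : 2 * ((E + 1)^-1 * (1 - (E + 1)^-1)) = 2 * E / (E + 1) ^+ 2.
  by field; rewrite gt_eqF//; lra.
rewrite ler_pdivlMr ?exprn_gt0//; last by lra.
have -> : E^-1 / 2 * (E + 1) ^+ 2 = (E + 1) ^+ 2 / (2 * E) by field; rewrite gt_eqF//; lra.
by rewrite ler_pdivrMr; nra.
Qed.

(** The prefactor is |1 - x e^(i th)|^2; the product telescopes by the three-term recurrence of cos
    (k th). *)
Lemma sum_pow_cos (N : nat) x th :
  (1 - 2 * x * cos th + x ^+ 2) * (\sum_(k < N) x ^+ k.+1 * cos (k.+1%:R * th)) =
  x * cos th - x ^+ 2 - x ^+ N.+1 * cos (N.+1%:R * th) + x ^+ N.+2 * cos (N%:R * th).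
Proof.
elim: N => [|N IHN].
  by rewrite big_ord0 mulr0 mul0r cos0 mul1r !mulr1 expr1; ring.
rewrite big_ord_recr /= mulrDr IHN.
have -> : cos (N.+2%:R * th) = 2 * cos (N.+1%:R * th) * cos th - cos (N%:R * th).
  have -> : N.+2%:R * th = N.+1%:R * th + th by rewrite -[N.+2%:R]natr1; ring.
  have -> : N%:R * th = N.+1%:R * th - th by rewrite -[N.+1%:R]natr1; ring.
  by rewrite cosD cosB; ring.
rewrite !exprS; ring.
Qed.

(** The main term is the value of the infinite series. Cutting at [N] leaves three boundary terms,
    each at most x^(N+1) / (1 - x)^2. *)
Lemma sum_pow_1subcos (N : nat) x th : 0 < x < 1 ->
  x * (1 + x) * (1 - cos th) / ((1 - x) * ((1 - x) ^+ 2 + 2 * x * (1 - cos th)))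
    - 3 * x ^+ N.+1 / (1 - x) ^+ 2
  <= \sum_(k < N) x ^+ k.+1 * (1 - cos (k.+1%:R * th)).
Proof.
move=> /andP[x0 x1]; set u := 1 - cos th; set d := 1 - x.
have u0 : 0 <= u by rewrite subr_ge0 cos_le1.
have d0 : 0 < d by rewrite subr_gt0.
have d1 : d <= 1 by rewrite gerBl ltW.
set Q := d ^+ 2 + 2 * x * u.
have Qd : d ^+ 2 <= Q by rewrite lerDl !mulr_ge0// ltW.
have d20 : 0 < d ^+ 2 by rewrite exprn_gt0.
have Q0 : 0 < Q by apply: lt_le_trans Qd.
have QE : Q = 1 - 2 * x * cos th + x ^+ 2 by rewrite /Q /u /d; ring.
have geo : \sum_(k < N) x ^+ k.+1 = (x - x ^+ N.+1) / d.
  elim: N => [|N IHN]; first by rewrite big_ord0 expr1 subrr mul0r.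
  rewrite big_ord_recr /= IHN [x ^+ N.+2]exprS /d.
  by field; rewrite gt_eqF// subr_gt0.
have cosS : \sum_(k < N) x ^+ k.+1 * cos (k.+1%:R * th) =
  (x * cos th - x ^+ 2 - x ^+ N.+1 * cos (N.+1%:R * th) + x ^+ N.+2 * cos (N%:R * th)) / Q.
  by rewrite -sum_pow_cos QE mulrC mulKf// -QE gt_eqF.
have -> : \sum_(k < N) x ^+ k.+1 * (1 - cos (k.+1%:R * th)) =
   \sum_(k < N) x ^+ k.+1 - \sum_(k < N) x ^+ k.+1 * cos (k.+1%:R * th).
  by rewrite -sumrB; apply: eq_bigr => k _; rewrite mulrBr mulr1.
rewrite geo cosS; set y := x ^+ N.+1; have y0 : 0 <= y by rewrite exprn_ge0// ltW.
have -> : x ^+ N.+2 = x * y by rewrite /y exprS.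
have -> : x * (1 + x) * u / (d * Q) = x / d - (x * cos th - x ^+ 2) / Q.
  have cE : cos th = 1 - u by rewrite /u; ring.
  have xE : x = 1 - d by rewrite /d; ring.
  have : Q != 0 by rewrite gt_eqF.
  have : d != 0 by rewrite gt_eqF.
  by rewrite /Q cE xE => d_neq0 Q_neq0; field; rewrite Q_neq0.
have b1 : y / d <= y / d ^+ 2.
  by apply: ler_wpM2l => //; rewrite lef_pV2 ?posrE// expr2 ler_piMr// ltW.
have b2 : y / Q <= y / d ^+ 2 by apply: ler_wpM2l => //; rewrite lef_pV2 ?posrE.
have yQ0 : 0 <= y / Q by rewrite divr_ge0// ltW.
have c1 : - (y / Q) <= y * cos (N.+1%:R * th) / Q.
  have := ler_wpM2r yQ0 (cos_geN1 (N.+1%:R * th)).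
  by rewrite mulN1r mulrCA mulrA.
have c2 : x * y * cos (N%:R * th) / Q <= y / Q.
  have -> : x * y * cos (N%:R * th) / Q = x * cos (N%:R * th) * (y / Q) by ring.
  rewrite -[leRHS]mul1r; apply: ler_wpM2r => //.
  by have := cos_le1 (N%:R * th); nra.
have -> : 3 * y / d ^+ 2 = 3 * (y / d ^+ 2) by ring.
rewrite !mulrDl !mulNr; lra.
Qed.

End LocalLimit.

(** * An integrable majorant for the rescaled characteristic function *)

Section Domination.
Context {R : realType}.
Implicit Types (x y t p th s : R).

Local Notation normc := (@Normc.normc R).

Lemma one_sub_cos_ge th : `|th| <= pi -> th ^+ 2 / 18 <= 1 - cos th.
Proof.
move=> thpi; have y0 : 0 <= `|th| / 2 by rewrite divr_ge0.
have y2 : `|th| / 2 <= 2 by have := @pi_lt4 R; lra.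
have := @sin_ge_third R (`|th| / 2); rewrite y0 y2 => /(_ isT) sy.
have -> : cos th = 1 - 2 * sin (`|th| / 2) ^+ 2.
  rewrite -cos_norm; have {1}-> : `|th| = (`|th| / 2) *+ 2 by rewrite -mulr_natr divfK.
  by rewrite cos_mulr2n cos2sin2; ring.
have -> : th ^+ 2 = `|th| ^+ 2 by rewrite real_normK ?num_real.
nra.
Qed.

(* [3072 = 6 * 8 ^ 3] comes from [y ^ 3 <= 6 * expR y] at [y = (8 * t)^-1] and
   [321 = 1 + 16 * 20] from [`|x| <= pi * s] and [s ^+ 2 <= 20 / t ^+ 3]. *)
Definition domination_cst : R := expR (1 / 2) * (3072 * 321).

Lemma domination_cst_ge0 : 0 <= domination_cst.
Proof. by apply: mulr_ge0; [exact: expR_ge0|lra]. Qed.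

(** Two regimes for u = 1 - cos th. If u <= t^2, the exponent is at least a multiple of x^2; if u >
    t^2, it is at least a multiple of 1 / t, and e^(-c/t) beats 1 + x^2 = O(t^(-3)). *)
Lemma recentred_char_fun_le (N n : nat) t s x :
  0 < t -> t <= 1 / 16 -> 0 < s -> s ^+ 2 <= 20 / t ^+ 3 ->
  3 * expR (- t) ^+ N.+1 / (1 - expR (- t)) ^+ 2 <= 1 ->
  `|x| <= pi * s ->
  `|recentred_char_fun N t n (x / s)| <= domination_cst / (1 + x ^+ 2).
Proof.
move=> t0 t16 s0 s20 tail xs; set th := x / s.
apply: le_trans (Re_le_normc _) _; rewrite Normc.normcM normc_cis mulr1.
apply: le_trans (normc_char_fun_le _ _ (ltW t0)) _.
have r1 : expR (- t) < 1 by rewrite expR_lt1; lra.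
have rt : 1 - t <= expR (- t) by have := expR_ge1Dx (- t); lra.
have r0 := expR_gt0 (- t).
have -> : \sum_(k < N) expR (- (k.+1%:R * t)) * (1 - cos (k.+1%:R * th)) / 2 =
    (\sum_(k < N) expR (- t) ^+ k.+1 * (1 - cos (k.+1%:R * th))) / 2.
  by rewrite mulr_suml; apply: eq_bigr => k _; rewrite -expRM_natl mulrN.
have := @sum_pow_1subcos R N (expR (- t)) th; rewrite r0 r1 => /(_ isT) low.
have thpi : `|th| <= pi.
  by rewrite normrM normfV (gtr0_norm s0) ler_pdivrMr.
have uth := one_sub_cos_ge thpi.
have x2 : x ^+ 2 = th ^+ 2 * s ^+ 2 by rewrite -exprMn divfK// gt_eqF.
move: low tail uth; set u := 1 - cos th; move: (expR (- t)) r1 rt r0 => r r1 rt r0 low tail uth.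
have u0 : 0 <= u by rewrite subr_ge0 cos_le1.
set main := r * (1 + r) * u / ((1 - r) * ((1 - r) ^+ 2 + 2 * r * u)) in low.
move: low; set S := \sum_(k < N) _ => low.
(* The loss 1 from the cut at [N], halved in the exponent, is the origin of the factor
   [expR (1 / 2)] of [domination_cst]. *)
have lowS : main - 1 <= S by lra.
have main_ge : u / (4 * (t * (t ^+ 2 + 2 * u))) * 3 <= main.
  have -> : u / (4 * (t * (t ^+ 2 + 2 * u))) * 3 = (3 / 4 * u) / (t * (t ^+ 2 + 2 * u)).
    by field; rewrite !gt_eqF// ltr_pwDl ?exprn_gt0// mulr_ge0.
  have q0 : 0 < (1 - r) ^+ 2 + 2 * r * u.
    by rewrite ltr_pwDl ?exprn_gt0 ?subr_gt0// mulr_ge0// mulr_ge0// ltW.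
  apply: ler_pM.
  - by rewrite mulr_ge0.
  - by rewrite invr_ge0 mulr_ge0 ?(ltW t0)// addr_ge0 ?sqr_ge0// mulr_ge0.
  - apply: ler_wpM2r => //; nra.
  - rewrite lef_pV2 ?posrE; last 2 first.
    + by rewrite mulr_gt0// ltr_pwDl ?exprn_gt0// mulr_ge0.
    + by rewrite mulr_gt0// subr_gt0.
    apply: ler_pM => //.
    + by rewrite subr_ge0 ltW.
    + exact: ltW.
    + by rewrite lerBlDr -lerBlDl.
    + apply: lerD; first by apply: lerXn2r; rewrite ?nnegrE ?subr_ge0; clear -t0 r1 rt; lra.
      by apply: ler_wpM2r => //; lra.
have t3 : 0 < t ^+ 3 by rewrite exprn_gt0.
have x20 : 0 <= x ^+ 2 := sqr_ge0 x.
have x21 : 0 < 1 + x ^+ 2 by rewrite ltr_wpDr.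
suff key K : K = 3072 * 321 -> expR (- (main / 2)) <= K / (1 + x ^+ 2).
  apply: (@le_trans _ _ (expR (1 / 2) * expR (- (main / 2)))).
    by rewrite -expRD ler_expR; clear -lowS; lra.
  by rewrite /domination_cst -mulrA; apply: ler_wpM2l; [exact: expR_ge0|exact: key].
move=> KE; have K0 : 0 < K by clear -KE; lra.
have [ut|tu] := leP u (t ^+ 2).
  have mainx : x ^+ 2 / 1440 <= main.
    apply: le_trans main_ge; apply: (@le_trans _ _ (u / (4 * t ^+ 3))).
      rewrite x2; have := ler_wpM2l (sqr_ge0 th) s20.
      move=> h; apply: (@le_trans _ _ (th ^+ 2 * (20 / t ^+ 3) / 1440)).
        by clear -h; lra.
      have -> : th ^+ 2 * (20 / t ^+ 3) / 1440 = th ^+ 2 / 18 * (4 * t ^+ 3)^-1.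
        by field; rewrite gt_eqF.
      by apply: ler_wpM2r => //; rewrite invr_ge0 mulr_ge0// ltW.
    have -> : u / (4 * t ^+ 3) = 3 * u * (12 * t ^+ 3)^-1 by field; rewrite gt_eqF.
    have -> : u / (4 * (t * (t ^+ 2 + 2 * u))) * 3 = 3 * u * (4 * (t * (t ^+ 2 + 2 * u)))^-1 by ring.
    apply: ler_wpM2l; first by rewrite mulr_ge0.
    rewrite lef_pV2 ?posrE ?mulr_gt0// ?ltr_pwDl ?exprn_gt0// ?mulr_ge0//.
    have := ler_wpM2l (ltW t0) ut; rewrite !exprS expr0; clear; lra.
  have := expR_ge1Dx (main / 2) => hm.
  rewrite expRN -[leRHS]invrK lef_pV2 ?posrE ?expR_gt0 ?invr_gt0 ?divr_gt0// invf_div.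
  by apply: le_trans hm; rewrite ler_pdivrMr// KE; clear -mainx x20; lra.
have maint : (4 * t)^-1 <= main.
  apply: le_trans main_ge.
  have -> : u / (4 * (t * (t ^+ 2 + 2 * u))) * 3 = (3 * u / (t ^+ 2 + 2 * u)) * (4 * t)^-1.
    by field; rewrite !gt_eqF// ltr_pwDl ?exprn_gt0// mulr_ge0.
  rewrite -[leLHS]mul1r; apply: ler_wpM2r; first by rewrite invr_ge0 mulr_ge0// ltW.
  by rewrite ler_pdivlMr ?ltr_pwDl ?exprn_gt0 ?mulr_ge0//; clear -tu; lra.
have y0 : 0 <= main / 2.
  by apply: le_trans (_ : 0 <= (4 * t)^-1 / 2) _; [rewrite divr_ge0// invr_ge0 mulr_ge0// ltW|clear -maint; lra].
have e3 := exprn_le_expR 3 y0.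
have y3 : ((8 * t)^-1) ^+ 3 <= (main / 2) ^+ 3.
  apply: lerXn2r; rewrite ?nnegrE//; first by rewrite invr_ge0 mulr_ge0// ltW.
  have -> : (8 * t)^-1 = (4 * t)^-1 / 2 by field; rewrite gt_eqF.
  by clear -maint; lra.
have x2t : 1 + x ^+ 2 <= 321 / t ^+ 3.
  have : x ^+ 2 <= 16 * (20 / t ^+ 3).
    have -> : x ^+ 2 = `|x| ^+ 2 by rewrite real_normK ?num_real.
    apply: (@le_trans _ _ ((pi * s) ^+ 2)).
      by rewrite ler_sqr ?nnegrE// mulr_ge0 ?pi_ge0// ltW.
    rewrite exprMn; apply: ler_pM; rewrite ?sqr_ge0//.
    by have := @pi_lt4 R; have := @pi_gt0 R; clear; nra.
  have : 1 <= 1 / t ^+ 3 by rewrite ler_pdivlMr// mul1r exprn_ile1 ?(ltW t0)//; clear -t16; lra.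
  by clear; lra.
rewrite expRN -[leRHS]invrK lef_pV2 ?posrE ?expR_gt0 ?invr_gt0 ?divr_gt0// invf_div.
rewrite ler_pdivrMr//; move: e3; rewrite (_ : 3`! = 6)%N// => e3.
have : 321 / t ^+ 3 = 321 * 512 * ((8 * t)^-1) ^+ 3 by field; rewrite gt_eqF.
by rewrite KE; clear -e3 y3 x2t; lra.
Qed.

End Domination.

(** * Extraction of a coefficient by Fourier inversion *)

Section FourierInversion.
Context {R : realType}.
Implicit Types (x y t p th s : R).

(** Factor by factor, (1 + q^k e^(ik th)) / (1 + q^k) is the characteristic function of a Bernoulli
    variable. *)
Lemma distinct_gf_char_fun (N : nat) t th :
  (map_poly (real_complex R) (distinct_gf N ^+ 2)).[(expR (- t))%:C%C * cis th] =
  (expR (2 * log_sum N t))%:C%C * char_fun N t th.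
Proof.
have -> : map_poly (real_complex R) (distinct_gf N ^+ 2) =
    (\prod_(k < N) (1 + 'X^(k.+1))) ^+ 2.
  rewrite rmorphXn rmorph_prod; congr (_ ^+ 2); apply: eq_bigr => k _.
  by rewrite rmorphD rmorph1 /= map_polyXn.
have -> : expR (2 * log_sum N t) = (\prod_(k < N) (1 + expR (- (k.+1%:R * t)))) ^+ 2.
  rewrite expRM_natl /log_sum expR_sum; congr (_ ^+ 2); apply: eq_bigr => k _.
  by rewrite lnK// posrE addr_gt0// expR_gt0.
rewrite horner_exp horner_prod rmorphXn rmorph_prod /char_fun prodrXl -exprMn -big_split /=.
congr (_ ^+ 2); apply: eq_bigr => k _.
rewrite hornerD hornerC hornerXn exprMn -cisMn -rmorphXn /=.
have -> : expR (- t) ^+ k.+1 = expR (- (k.+1%:R * t)) by rewrite -expRM_natl mulrN.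
rewrite /fermi expRN; have E0 := expR_gt0 (k.+1%:R * t).
move: (expR _) E0 => E E0; have E10 : 0 < E + 1 by rewrite addr_gt0.
rewrite /bernoulli_cf /cis /real_complex_def /=; apply/eqP; rewrite eq_complex /=.
by apply/andP; split; apply/eqP; field; rewrite !gt_eqF.
Qed.

Lemma recentred_char_fun_cos (N n : nat) t th :
  expR (2 * log_sum N t) * recentred_char_fun N t n th =
  \sum_(j < size (distinct_gf N ^+ 2 : {poly R}))
    (distinct_gf N ^+ 2)`_j * expR (- (j%:R * t)) * cos ((j%:R - n%:R) * th).
Proof.
set P : {poly R} := distinct_gf N ^+ 2.
have -> : expR (2 * log_sum N t) * recentred_char_fun N t n th =
    complex.Re ((map_poly (real_complex R) P).[(expR (- t))%:C%C * cis th] * cis (- (n%:R * th))).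
  rewrite distinct_gf_char_fun -mulrA /recentred_char_fun.
  by case: (_ * cis _) => a b /=; rewrite mul0r subr0.
rewrite horner_coef size_map_poly mulr_suml raddf_sum; apply: eq_bigr => j _.
rewrite coef_map /= exprMn -cisMn -rmorphXn /=.
have -> : expR (- t) ^+ j = expR (- (j%:R * t)) by rewrite -expRM_natl mulrN.
have -> : (j%:R - n%:R) * th = j%:R * th - n%:R * th by rewrite mulrBl.
by rewrite cosB cosN sinN; ring.
Qed.

Lemma sin_natpi (n : nat) : sin (n%:R * pi) = 0 :> R.
Proof.
elim: n => [|n IHn]; first by rewrite mul0r sin0.
by rewrite -natr1 mulrDl mul1r sinDpi IHn oppr0.
Qed.

Lemma sin_intpi (m n : nat) : sin ((m%:R - n%:R) * pi) = 0 :> R.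
Proof. by rewrite mulrBl sinB !sin_natpi mul0r mulr0 subrr. Qed.

Lemma is_derive_sumr (m : nat) (F dF : nat -> R -> R) x :
  (forall j, is_derive x (1 : R) (F j) (dF j x)) ->
  is_derive x (1 : R) (fun y => \sum_(j < m) F j y) (\sum_(j < m) dF j x).
Proof.
move=> FD; have -> : (fun y => \sum_(j < m) F j y) = \sum_(j < m) F j.
  by apply/funext => y; rewrite fct_sumE.
by apply: is_derive_sum => j; exact: FD.
Qed.

(** The integrand is a finite sum of cosines with explicit primitives [F j]; at both endpoints the
    sines are taken at integer multiples of pi, so only frequency zero, j = n, survives. *)
Lemma fourier_inversion (N n : nat) t s : 0 < s ->
  (\int[lebesgue_measure]_(x in `[(- (pi * s))%R, (pi * s)%R]) (recentred_char_fun N t n (x / s))%:E =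
  ((distinct_gf N ^+ 2)`_n * expR (- (n%:R * t)) / expR (2 * log_sum N t) * (2 * (pi * s)))%R%:E)%E.
Proof.
move=> s0; set P : {poly R} := distinct_gf N ^+ 2; set D := expR (2 * log_sum N t).
have D0 : 0 < D := expR_gt0 _.
pose f j x := P`_j * expR (- (j%:R * t)) / D * cos ((j%:R - n%:R) * (x / s)) : R.
pose F j x := P`_j * expR (- (j%:R * t)) / D *
  (if j == n then x else s / (j%:R - n%:R) * sin ((j%:R - n%:R) / s * x)) : R.
have recE x : recentred_char_fun N t n (x / s) = \sum_(j < size P) f j x.
  apply: (mulfI (lt0r_neq0 D0)); rewrite recentred_char_fun_cos mulr_sumr.
  by apply: eq_bigr => j _; rewrite /f; field; rewrite gt_eqF.
have FD j x : is_derive x (1 : R) (F j) (f j x).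
  rewrite /F /f; have [->|jn] := eqVneq j n.
    by apply: is_derive_eq; rewrite /GRing.scale /= subrr mul0r cos0; ring.
  have jn0 : j%:R - n%:R != 0 :> R by rewrite subr_eq0 eqr_nat.
  apply: is_derive_eq; rewrite /GRing.scale /=.
  have -> : (j%:R - n%:R) / s * x = (j%:R - n%:R) * (x / s) by ring.
  set c := cos _; move: jn0; set d := _ - _ => d0.
  by field; rewrite d0 !gt_eqF.
have SD x : is_derive x (1 : R) (fun y => \sum_(j < size P) F j y) (\sum_(j < size P) f j x).
  exact: is_derive_sumr.
have ps : 0 < pi * s by rewrite mulr_gt0 ?pi_gt0.
under eq_integral do rewrite recE.
rewrite (@continuous_FTC2 _ _ (fun y => \sum_(j < size P) F j y)).
- rewrite -EFinB -sumrB; congr EFin.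
  have Fend (j : nat) : F j (pi * s) - F j (- (pi * s)) =
      if j == n then P`_n * expR (- (n%:R * t)) / D * (2 * (pi * s)) else 0.
    rewrite /F; have [->|jn] := eqVneq j n; first by ring.
    have -> : (j%:R - n%:R) / s * (pi * s) = (j%:R - n%:R) * pi by field; rewrite gt_eqF.
    have -> : (j%:R - n%:R) / s * - (pi * s) = - ((j%:R - n%:R) * pi) by field; rewrite gt_eqF.
    by rewrite sinN sin_intpi oppr0 subrr.
  under eq_bigr do rewrite Fend.
  have [nP|Pn] := ltnP n (size P).
    rewrite (bigD1 (Ordinal nP)) //= eqxx big1 ?addr0// => j jn.
    by rewrite ifN//; apply: contra jn => /eqP jn; apply/eqP/val_inj.
  rewrite big1 => [|j _]; first by rewrite nth_default// !mul0r.
  by rewrite ifN// neq_ltn (leq_trans (ltn_ord j)).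
- by rewrite -subr_gt0; lra.
- apply: continuous_in_subspaceT => x _.
  apply: differentiable_continuous; apply/derivable1_diffP.
  suff: is_derive x (1 : R) (fun y => \sum_(j < size P) f j y) (\sum_(j < size P)
    P`_j * expR (- (j%:R * t)) / D * (- sin ((j%:R - n%:R) * (x / s)) * ((j%:R - n%:R) / s))).
    by case.
  apply: (@is_derive_sumr (size P) f (fun j y =>
    P`_j * expR (- (j%:R * t)) / D * (- sin ((j%:R - n%:R) * (y / s)) * ((j%:R - n%:R) / s)))).
  move=> j; rewrite /f; apply: is_derive_eq; rewrite /GRing.scale /=; ring.
- split => [x _| |].
  + by case: (SD x).
  + apply: cvg_at_right_filter; apply: differentiable_continuous; apply/derivable1_diffP.
    by case: (SD (- (pi * s))).
  + apply: cvg_at_left_filter; apply: differentiable_continuous; apply/derivable1_diffP.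
    by case: (SD (pi * s)).
- by move=> x _; rewrite derive1E; case: (SD x).
Qed.

End FourierInversion.

(** * The local limit theorem *)

Section DominatedLimit.
Context {R : realType}.
Implicit Types (x y t p th s : R).

Lemma cvg_dist_le (a b : R^nat) (l : R) :
  (\forall k \near \oo, `|a k - l| <= b k) -> b @ \oo --> (0 : R) -> a @ \oo --> l.
Proof.
move=> ab b0; apply: (@squeeze_cvgr _ _ _ _ (fun k => l - b k) (fun k => l + b k)).
- by apply: filterS ab => k; rewrite ler_norml; lra.
- by rewrite -[X in _ --> X]subr0; apply: cvgB => //; exact: cvg_cst.
- by rewrite -[X in _ --> X]addr0; apply: cvgD => //; exact: cvg_cst.
Qed.

Lemma continuous_recentred_char_fun (N n : nat) t s :
  continuous (fun x => recentred_char_fun N t n (x / s)).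
Proof.
pose c j : R := (distinct_gf N ^+ 2)`_j * expR (- (j%:R * t)).
pose f j x : R := c j * cos ((j%:R - n%:R) * (x / s)).
have recE : (fun x => recentred_char_fun N t n (x / s)) = (fun x => (expR (2 * log_sum N t))^-1 *
    \sum_(j < size (distinct_gf N ^+ 2 : {poly R})) f j x).
  apply/funext => x; have D0 := expR_gt0 (2 * log_sum N t).
  by apply: (mulfI (lt0r_neq0 D0)); rewrite recentred_char_fun_cos mulVKf// gt_eqF.
rewrite recE => x; apply: differentiable_continuous; apply/derivable1_diffP.
have FD j : is_derive x (1 : R) (f j) (c j * (- sin ((j%:R - n%:R) * (x / s)) * ((j%:R - n%:R) / s))).
  by rewrite /f; apply: is_derive_eq; rewrite /GRing.scale /=; ring.
have ? := @is_derive_sumr R (size (distinct_gf N ^+ 2 : {poly R})) f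
  (fun j y => c j * (- sin ((j%:R - n%:R) * (y / s)) * ((j%:R - n%:R) / s))) x FD.
by apply: ex_derive.
Qed.

Lemma integrable_oneDsqrV (c : R) :
  lebesgue_measure.-integrable [set: R] (fun x => (c * (oneDsqr x)^-1)%:E).
Proof.
have cV : continuous (fun x : R => (oneDsqr x)^-1) by exact: continuous_oneDsqrV.
have intV : lebesgue_measure.-integrable [set: R] (fun x => ((oneDsqr x)^-1)%:E).
  apply/integrableP; split; first by apply/measurable_EFinP; exact: continuous_measurable_fun.
  under eq_integral do rewrite abse_EFin ger0_norm ?invr_ge0 ?(le_trans ler01)//.
  rewrite ge0_symfun_integralT//.
  - rewrite (_ : [set x | _] = `[0, +oo[%classic); last first.
      by apply/seteqP; split => x /=; rewrite in_itv /= andbT.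
    by rewrite integral0y_oneDsqr -EFinM ltry.
  - by move=> x /=; rewrite /oneDsqr sqrrN.
under eq_fun do rewrite EFinM.
exact: integrableZl.
Qed.

Lemma integral_gauss :
  (\int[lebesgue_measure]_x (expR (- (x ^+ 2 / 2)))%:E = (Num.sqrt (2 * pi) : R)%:E)%E.
Proof.
have pi0 := @pi_gt0 R.
have pE : (fun x : R => (expR (- (x ^+ 2 / 2)))%:E) =
    (fun x => (Num.sqrt (2 * pi))%:E * (normal_pdf 0 1 x)%:E)%E.
  apply/funext => x; rewrite -EFinM normal_pdfE ?oner_eq0// /normal_peak /normal_fun.
  rewrite expr1n mul1r subr0 -[pi *+ 2]mulr_natl mulrA divff ?mul1r; last first.
    by rewrite gt_eqF// sqrtr_gt0 mulr_gt0.
  by rewrite mulNr.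
rewrite pE integralZl//; last exact: integrable_normal_pdf.
by rewrite integral_normal_pdf mule1.
Qed.

Lemma inv_le_mul_sqrt t s : 0 < t -> 0 < s -> 1 / t ^+ 3 <= s ^+ 2 ->
  s^-1 <= t * Num.sqrt t.
Proof.
move=> t0 s0 ts; have tau0 : 0 < t * Num.sqrt t by rewrite mulr_gt0 ?sqrtr_gt0.
rewrite -[leRHS]invrK lef_pV2 ?posrE ?invr_gt0//.
rewrite -(@ler_pXn2r _ 2%N) ?nnegrE ?invr_ge0 ?(ltW s0) ?(ltW tau0)//.
apply: le_trans ts; rewrite exprVn exprMn sqr_sqrtr ?(ltW t0)// mul1r.
by rewrite -exprSr.
Qed.

(** Scaling by the exact standard deviation [s] makes the Gaussian exactly exp (-x^2 / 2), so crude
    bounds on [s] suffice: the upper one for the majorant, the lower one for pointwise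
    convergence. *)
Theorem local_limit (N n : nat -> nat) (t s : R^nat) :
  (forall k, 0 < t k) -> (forall k, t k <= 1 / 16) -> (forall k, 0 < s k) ->
  (forall k, s k ^+ 2 = 2 * var_sum (N k) (t k)) ->
  (forall k, s k ^+ 2 <= 20 / t k ^+ 3) ->
  (forall k, 1 / t k ^+ 3 <= s k ^+ 2) ->
  (forall k, 3 * expR (- t k) ^+ (N k).+1 / (1 - expR (- t k)) ^+ 2 <= 1) ->
  t @ \oo --> (0 : R) ->
  (fun k => (2 * mean_sum (N k) (t k) - (n k)%:R) / s k) @ \oo --> (0 : R) ->
  (fun k => (distinct_gf (N k) ^+ 2)`_(n k) * expR (- ((n k)%:R * t k)) /
    expR (2 * log_sum (N k) (t k)) * (2 * (pi * s k))) @ \oo --> Num.sqrt (2 * pi).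
Proof.
move=> t0 t16 s0 sE s20 s1 tail tcvg dcvg.
pose I k := `[(- (pi * s k)), (pi * s k)]%classic : set R.
pose f_ k x := (\1_(I k) x * recentred_char_fun (N k) (t k) (n k) (x / s k) : R)%:E.
have int_f k : (\int[lebesgue_measure]_x f_ k x)%E =
    ((distinct_gf (N k) ^+ 2)`_(n k) * expR (- ((n k)%:R * t k)) /
    expR (2 * log_sum (N k) (t k)) * (2 * (pi * s k)))%:E.
  rewrite -fourier_inversion// [RHS]integral_mkcond; apply: eq_integral => x _.
  by rewrite /f_ indicE patchE; case: (x \in I k); rewrite ?mul1r ?mul0r.
have ptwise (x : R) : (fun k => f_ k x) @ \oo --> (expR (- (x ^+ 2 / 2)))%:E.
  pose d k : R := (2 * mean_sum (N k) (t k) - (n k)%:R) / s k * x.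
  have d0 : d @ \oo --> (0 : R).
    by rewrite -[X in _ --> X](mul0r x); apply: cvgM => //; exact: cvg_cst.
  apply: cvg_EFin; first by exact: nearW.
  apply: (@cvg_dist_le _ (fun k => 1536 * x ^+ 4 * t k + 192 * `|x| ^+ 3 * Num.sqrt (t k)
      + (d k * d k / 2 + `|d k|))).
    near=> k.
    have tk := t0 k; have sk := s0 k; have t3k : 0 < t k ^+ 3 by rewrite exprn_gt0.
    (* The window of half-width pi s eventually contains x, as s >= t^(-3/2) >= 1 / t. *)
    have xI : x \in I k.
      have tx : t k <= (x ^+ 2 + 1)^-1.
        near: k; apply: (cvgr_le _ tcvg); rewrite invr_gt0 ltr_wpDl ?sqr_ge0//.
      have xs : `|x| <= s k.
        rewrite -(@ler_pXn2r _ 2%N) ?nnegrE ?normr_ge0 ?(ltW sk)// real_normK ?num_real//.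
        apply: le_trans (s1 k); rewrite mul1r.
        apply: (@le_trans _ _ (t k)^-1).
          have x21 : 0 < x ^+ 2 + 1 by rewrite ltr_wpDl ?sqr_ge0.
          apply: (@le_trans _ _ (x ^+ 2 + 1)); first by rewrite lerDl.
          by rewrite -[leLHS]invrK lef_pV2 ?posrE ?invr_gt0.
        by rewrite lef_pV2 ?posrE// exprS ger_pMr// exprn_ile1 ?(ltW tk)// (le_trans (t16 k))//; lra.
      rewrite inE /I /= in_itv /= -ler_norml; apply: le_trans xs _.
      rewrite ler_peMl ?ltW//; have := @pihalf_ge1 R; lra.
    rewrite /f_ /= indicE xI mul1r.
    have := @recentred_char_fun_gauss R (N k) (n k) (t k) (x / s k) (d k) tk ltac:(by rewrite /d; ring).
    have -> : var_sum (N k) (t k) * (x / s k) ^+ 2 = x ^+ 2 / 2.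
      have -> : var_sum (N k) (t k) = s k ^+ 2 / 2 by rewrite sE; field.
      by field; rewrite gt_eqF.
    (* As 1 / s <= t^(3/2), the quartic error is O(t^6 / t^5) and the cubic one O(t^(9/2) / t^4). *)
    pose tau := t k * Num.sqrt (t k).
    have tau0 : 0 < tau by rewrite mulr_gt0 ?sqrtr_gt0.
    have tau2 : Num.sqrt (t k) ^+ 2 = t k by rewrite sqr_sqrtr// ltW.
    have stau : (s k)^-1 <= tau by exact: inv_le_mul_sqrt.
    have sV0 : 0 <= (s k)^-1 by rewrite invr_ge0 ltW.
    have e1 : (x / s k) ^+ 4 / t k ^+ 5 <= x ^+ 4 * t k.
      rewrite exprMn -mulrA; apply: ler_wpM2l; first by rewrite exprn_even_ge0.
      rewrite ler_pdivrMr ?exprn_gt0//.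
      have -> : t k * t k ^+ 5 = tau ^+ 4.
        by rewrite /tau exprMn (exprM (Num.sqrt _) 2 2) tau2; ring.
      by apply: lerXn2r; rewrite ?nnegrE ?(ltW tau0).
    have e2 : `|x / s k| ^+ 3 / t k ^+ 4 <= `|x| ^+ 3 * Num.sqrt (t k).
      rewrite normrM exprMn -mulrA; apply: ler_wpM2l; first by rewrite exprn_ge0.
      rewrite ger0_norm// ler_pdivrMr ?exprn_gt0//.
      have -> : Num.sqrt (t k) * t k ^+ 4 = tau ^+ 3.
        by rewrite /tau exprMn [_ ^+ 3 in RHS]exprS [Num.sqrt _ ^+ 3]exprS tau2; ring.
      by apply: lerXn2r; rewrite ?nnegrE ?(ltW tau0).
    move=> /le_trans; apply; rewrite -expr2 lerD2r.
    by apply: lerD; rewrite -[leLHS]mulrA -[leRHS]mulrA ler_pM2l ?ltr0n.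
  have st0 : (fun k => Num.sqrt (t k)) @ \oo --> (0 : R).
    rewrite -[X in _ --> X]sqrtr0; apply: continuous_cvg => //.
    exact: sqrt_continuous.
  have z1 : (fun k => 1536 * x ^+ 4 * t k) @ \oo --> (0 : R).
    by rewrite -[X in _ --> X](mulr0 (1536 * x ^+ 4)); apply: cvgM => //; exact: cvg_cst.
  have z2 : (fun k => 192 * `|x| ^+ 3 * Num.sqrt (t k)) @ \oo --> (0 : R).
    by rewrite -[X in _ --> X](mulr0 (192 * `|x| ^+ 3)); apply: cvgM => //; exact: cvg_cst.
  have z3 : (fun k => d k * d k / 2) @ \oo --> (0 : R).
    rewrite -[X in _ --> X](mul0r (2^-1 : R)) -[X in X * _](mul0r (0 : R)).
    by apply: cvgM; [exact: cvgM|exact: cvg_cst].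
  have z4 : (fun k => `|d k|) @ \oo --> (0 : R).
    by rewrite -[X in _ --> X](@normr0 _ R); exact: cvg_norm.
  rewrite -[X in _ --> X]addr0; apply: cvgD.
    by rewrite -[X in _ --> X]addr0; exact: cvgD.
  by rewrite -[X in _ --> X]addr0; exact: cvgD.
have dom (x : R) k : (`|f_ k x| <= (domination_cst * (oneDsqr x)^-1)%:E)%E.
  rewrite /f_ abse_EFin lee_fin normrM indicE.
  have C0 : 0 <= (domination_cst : R) by exact: domination_cst_ge0.
  case: (boolP (x \in I k)) => [|_]; last first.
    by rewrite normr0 mul0r mulr_ge0// invr_ge0 ltW.
  rewrite inE /I /= in_itv /= => /andP[xl xu]; rewrite normr1 mul1r.
  by apply: recentred_char_fun_le => //; rewrite ler_norml xl.
have [|||||_ _] := @dominated_convergence _ _ R (@lebesgue_measure R) setT measurableT f_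
  (fun x => (expR (- (x ^+ 2 / 2)))%:E) (fun x => (domination_cst * (oneDsqr x)^-1)%:E).
- move=> k; apply/measurable_EFinP; apply: measurable_funM.
    by apply: measurable_indic; exact: measurable_itv.
  by apply: continuous_measurable_fun; exact: continuous_recentred_char_fun.
- apply/measurable_EFinP; apply: continuous_measurable_fun => x.
  apply: differentiable_continuous; apply/derivable1_diffP.
  by apply: ex_derive.
- by apply: aeW => x _; exact: ptwise.
- exact: integrable_oneDsqrV.
- by apply: aeW => x k _; exact: dom.
rewrite integral_gauss => h.
move/fine_cvgP : h => [_]; rewrite /= => h.
apply: cvg_trans h; apply: near_eq_cvg; apply: nearW => k /=.
by rewrite int_f.
Unshelve. all: by end_near.
Qed.

End DominatedLimit.

(** * Asymptotics of pairs of partitions into odd parts *)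

Section Asymptotics.
Context {R : realType}.

(* That is [pi / sqrt (6 n)], with the junk value [0] at [n = 0]. *)
Definition saddle (n : nat) : R := Num.sqrt (pi ^+ 2 / (6 * n%:R)).

Lemma saddle_gt0 (n : nat) : (0 < n)%N -> 0 < saddle n.
Proof.
by move=> n0; rewrite sqrtr_gt0 divr_gt0 ?exprn_gt0 ?pi_gt0// mulr_gt0// ltr0n.
Qed.

Lemma saddle2 (n : nat) : saddle n ^+ 2 = pi ^+ 2 / (6 * n%:R).
Proof. by rewrite sqr_sqrtr// divr_ge0 ?sqr_ge0// mulr_ge0. Qed.

Lemma cvg_saddle : saddle @ \oo --> (0 : R).
Proof.
rewrite -(cvg_shiftS saddle).
suff : (fun k : nat => Num.sqrt (pi ^+ 2 / 6 * k.+1%:R^-1)) @ \oo --> Num.sqrt (0 : R).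
  rewrite sqrtr0; apply: cvg_trans; apply: near_eq_cvg; apply: nearW => k.
  by rewrite /= /saddle invfM mulrA.
apply: continuous_cvg; first exact: sqrt_continuous.
rewrite -[X in _ --> X](mulr0 (pi ^+ 2 / 6)).
by apply: cvgM; [exact: cvg_cst|exact: cvg_harmonic].
Qed.

Lemma natr_saddle (n : nat) : (0 < n)%N -> n%:R = pi ^+ 2 / (6 * saddle n ^+ 2).
Proof.
move=> n0; rewrite saddle2; have := @pi_gt0 R; have : 0 < n%:R :> R by rewrite ltr0n.
move: (pi : R) (n%:R : R) => p m m0 p0.
by field; rewrite !gt_eqF.
Qed.

(** Times pi this is pi^2 / (3 t), the sum of n t and the leading term of log P(q). *)
Lemma sqrt_saddle (n : nat) : (0 < n)%N ->
  Num.sqrt (2 * n%:R / 3) = pi / (3 * saddle n).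
Proof.
move=> n0; have t0 := saddle_gt0 n0; have p0 := @pi_gt0 R.
have r0 : 0 <= pi / (3 * saddle n) by rewrite divr_ge0 ?pi_ge0// mulr_ge0// ltW.
rewrite -[RHS]ger0_norm// -sqrtr_sqr (natr_saddle n0); congr Num.sqrt.
move: (pi : R) (saddle n) t0 => p t t0.
by field; rewrite gt_eqF.
Qed.

Lemma powR4 (a : R) (m : nat) : 0 <= a -> (a `^ (m%:R / 4)) ^+ 4 = a ^+ m.
Proof.
move=> a0; rewrite -powR_mulrn ?powR_ge0// -powRrM divfK ?pnatr_eq0//.
by rewrite powR_mulrn.
Qed.

(** Half of the denominator in the final theorem, because pp(n) is asymptotically 2 ou(n). *)
Definition pairs_scale (n : nat) : R := 2 `^ (9 / 4) * 3 `^ (1 / 4) * n%:R `^ (3 / 4).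

Lemma pairs_scale_gt0 (n : nat) : (0 < n)%N -> 0 < pairs_scale n.
Proof. by move=> n0; rewrite !mulr_gt0 ?powR_gt0 ?ltr0n. Qed.

Lemma pairs_scale2 (n : nat) : (0 < n)%N ->
  pairs_scale n ^+ 2 = 8 * pi ^+ 3 / (3 * saddle n ^+ 3).
Proof.
move=> n0; have t0 := saddle_gt0 n0; have p0 := @pi_gt0 R.
have r0 : 0 <= 8 * pi ^+ 3 / (3 * saddle n ^+ 3).
  by rewrite divr_ge0 ?mulr_ge0 ?exprn_ge0 ?pi_ge0 ?(ltW t0).
(* Squaring once more turns the quarter powers into integer powers. *)
apply: (@pexpIrn _ 2); rewrite ?nnegrE ?exprn_ge0 ?(ltW (pairs_scale_gt0 n0))//.
have -> : (pairs_scale n ^+ 2) ^+ 2 = 2 ^+ 9 * 3 * n%:R ^+ 3.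
  rewrite -exprM /pairs_scale !exprMn (@powR4 2 9); last exact: ler0n.
  by rewrite (@powR4 3 1) ?ler0n// (@powR4 n%:R 3) ?ler0n.
rewrite (natr_saddle n0).
move: (pi : R) p0 (saddle n) t0 => p p0 t t0.
by field; rewrite gt_eqF.
Qed.

Definition pairs_main (n : nat) : R := expR (pi * Num.sqrt (2 * n%:R / 3)) / pairs_scale n.

Lemma exists_truncation (n : nat) : (0 < n)%N -> saddle n <= (1 / 168) ^+ 2 ->
  exists N : nat, [/\ (n <= N)%N,
    `|log_sum N (saddle n) - (pi ^+ 2 / 12 / saddle n - ln 2 / 2)| <= 2 * saddle n,
    `|mean_sum N (saddle n) - pi ^+ 2 / 12 / saddle n ^+ 2| <= 7 / saddle n,
    `|var_sum N (saddle n) - 2 * (pi ^+ 2 / 12) / saddle n ^+ 3|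
        <= 28 * Num.sqrt (saddle n) / saddle n ^+ 3 &
    3 * expR (- saddle n) ^+ N.+1 / (1 - expR (- saddle n)) ^+ 2 <= 1].
Proof.
move=> n0; have t0 := saddle_gt0 n0; move: (saddle n) t0 => t t0 t168.
have c0 : 0 < (1 - expR (- t)) ^+ 2 by apply: exprn_gt0; rewrite subr_gt0 expR_lt1 oppr_lt0.
have ct0 := mulr_gt0 c0 t0.
near \oo => N; exists N; split.
- by near: N; exact: nbhs_infty_ge.
- by near: N; exact: log_sum_asymp.
- by near: N; apply: mean_sum_asymp => //; lra.
- by near: N; apply: var_sum_asymp => //; lra.
- rewrite ler_pdivrMr// mul1r -expRM_natl mulrN.
  apply: (@le_trans _ _ (3 * (N.+1%:R * t)^-1)).
    by rewrite ler_pM2l// expRN_le_inv// mulr_gt0.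
  rewrite ler_pdivrMr ?mulr_gt0//.
  have : 3 / ((1 - expR (- t)) ^+ 2 * t) < N.+1%:R.
    near: N; exists (Num.trunc (3 / ((1 - expR (- t)) ^+ 2 * t))).+1 => // N /= NP.
    by apply: lt_le_trans (truncnS_gt _) _; rewrite ler_nat ltnW.
  rewrite ltr_pdivrMr// => /ltW /le_trans; apply.
  by rewrite le_eqVlt; apply/orP; left; apply/eqP; ring.
Unshelve. all: by end_near.
Qed.

(** The ratio factors as Z Y / X: Z tends to sqrt (2 pi) by the local limit theorem, Y to 1 / 2 by
    the expansion of log P(q), and X to sqrt (pi / 2) by the variance. *)
Theorem size_odd_partition_pairs_asymp :
  (fun n => (size (odd_partition_pairs n))%:R / pairs_main n) @ \oo --> (1 : R).
Proof.
have [K KP] : exists K : nat, forall n, (K <= n)%N -> saddle n <= (1 / 168) ^+ 2.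
  have : \forall n \near \oo, saddle n <= (1 / 168) ^+ 2.
    by apply: (cvgr_le _ cvg_saddle); apply: exprn_gt0; lra.
  by move=> [K _ KP]; exists K => n; exact: KP.
(* The shift makes the smallness of t hold for every index, as [local_limit] demands. *)
pose n k := (k + K.+1)%N.
rewrite -(cvg_shiftn K.+1); pose t k := saddle (n k).
have n0 k : (0 < n k)%N by rewrite /n addnS.
have nK k : t k <= (1 / 168) ^+ 2 by apply: KP; rewrite /n; lia.
have t0 k : 0 < t k := saddle_gt0 (n0 k).
have tcvg : t @ \oo --> (0 : R) by rewrite (cvg_shiftn K.+1 saddle); exact: cvg_saddle.
have /choice[N NP] : forall k, exists N : nat, [/\ (n k <= N)%N,
    `|log_sum N (t k) - (pi ^+ 2 / 12 / t k - ln 2 / 2)| <= 2 * t k,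
    `|mean_sum N (t k) - pi ^+ 2 / 12 / t k ^+ 2| <= 7 / t k,
    `|var_sum N (t k) - 2 * (pi ^+ 2 / 12) / t k ^+ 3| <= 28 * Num.sqrt (t k) / t k ^+ 3 &
    3 * expR (- t k) ^+ N.+1 / (1 - expR (- t k)) ^+ 2 <= 1].
  by move=> k; exact: exists_truncation (n0 k) (nK k).
have p0 := @pi_gt0 R; have p2 : 2 <= (pi : R) by have := @pihalf_ge1 R; lra.
have p4 := @pi_lt4 R.
have st k : Num.sqrt (t k) <= 1 / 168.
  apply: le_trans (ler_wsqrtr (nK k)) _.
  by rewrite sqrtr_sqr ger0_norm ?lexx// divr_ge0 ?ler0n.
have t3 k : 0 < t k ^+ 3 by rewrite exprn_gt0.
pose s k := Num.sqrt (2 * var_sum (N k) (t k)).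
have varE k : `|2 * var_sum (N k) (t k) * t k ^+ 3 - pi ^+ 2 / 3| <= 56 * Num.sqrt (t k).
  have [_ _ _ h _] := NP k.
  have -> : 2 * var_sum (N k) (t k) * t k ^+ 3 - pi ^+ 2 / 3 =
    2 * t k ^+ 3 * (var_sum (N k) (t k) - 2 * (pi ^+ 2 / 12) / t k ^+ 3).
    by move: (pi : R) (t k) (t0 k) (var_sum _ _) => p u u0 v; field; rewrite gt_eqF.
  rewrite normrM ger0_norm; last by rewrite mulr_ge0// ltW.
  apply: le_trans (ler_wpM2l _ h) _; first by rewrite mulr_ge0// ltW.
  by move: (t k) (t0 k) => u u0; rewrite le_eqVlt; apply/orP; left; apply/eqP; field; rewrite gt_eqF.
have st0 k : 0 <= Num.sqrt (t k) by exact: sqrtr_ge0.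
(* The threshold 1 / 168 makes the error 56 sqrt t at most 1 / 3, and pi^2 / 3 lies between 4 / 3
   and 16 / 3. *)
have var_bounds k : 1 <= 2 * var_sum (N k) (t k) * t k ^+ 3 <= 20.
  have := varE k; have := st k; have := st0 k; rewrite ler_norml.
  move: (Num.sqrt _) (2 * _ * _) => q v q0 q1 /andP[h1 h2].
  by apply/andP; split; nra.
have var0 k : 0 < 2 * var_sum (N k) (t k).
  have /andP[v1 _] := var_bounds k; rewrite -(pmulr_lgt0 _ (t3 k)).
  exact: lt_le_trans v1.
have s2 k : s k ^+ 2 = 2 * var_sum (N k) (t k) by rewrite sqr_sqrtr// ltW.
have s0 k : 0 < s k by rewrite sqrtr_gt0.
have s_ge k : 1 / t k ^+ 3 <= s k ^+ 2.
  by rewrite s2 ler_pdivrMr//; have /andP[] := var_bounds k.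
have sqt_cvg : (fun k => Num.sqrt (t k)) @ \oo --> (0 : R).
  rewrite -[X in _ --> X]sqrtr0; apply: continuous_cvg => //.
  exact: sqrt_continuous.
have natrE k : (n k)%:R = pi ^+ 2 / (6 * t k ^+ 2) :> R := natr_saddle (n0 k).
have Zcvg := @local_limit R N n t s t0 _ s0 s2 _ s_ge _ tcvg _.
have {Zcvg} Zcvg : (fun k => (size (odd_partition_pairs (n k)))%:R * expR (- ((n k)%:R * t k)) /
    expR (2 * log_sum (N k) (t k)) * (2 * (pi * s k))) @ \oo --> Num.sqrt (2 * pi).
  have sizeE k : (size (odd_partition_pairs (n k)))%:R = (distinct_gf (N k) ^+ 2)`_(n k) :> R.
    by apply: size_odd_partition_pairs; have [] := NP k.
  under eq_fun do rewrite sizeE.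
  apply: Zcvg.
  - by move=> k; apply: le_trans (nK k) _; lra.
  - by move=> k; rewrite s2 ler_pdivlMr//; have /andP[] := var_bounds k.
  - by move=> k; have [] := NP k.
  - apply: (@cvg_dist_le _ _ (fun k => 14 * Num.sqrt (t k))); last first.
      by rewrite -[X in _ --> X](mulr0 14); apply: cvgM => //; exact: cvg_cst.
    apply: nearW => k; rewrite subr0 normrM [X in _ * X <= _]ger0_norm ?invr_ge0 ?(ltW (s0 k))//.
    have [_ _ h _ _] := NP k.
    (* Divided by s >= t^(-3/2), this mismatch is at most 14 sqrt t. *)
    have h2 : `|2 * mean_sum (N k) (t k) - (n k)%:R| <= 14 / t k.
      have -> : 2 * mean_sum (N k) (t k) - (n k)%:R =
         2 * (mean_sum (N k) (t k) - pi ^+ 2 / 12 / t k ^+ 2).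
        rewrite natrE; move: (pi : R) (t k) (t0 k) (mean_sum _ _) => p u u0 v.
        by field; rewrite gt_eqF.
      by rewrite normrM ger0_norm//; lra.
    apply: (@le_trans _ _ (14 / t k * (t k * Num.sqrt (t k)))).
      by apply: ler_pM; rewrite ?invr_ge0 ?(ltW (s0 k))//; exact: inv_le_mul_sqrt.
    move: (t k) (t0 k) (Num.sqrt _) => u u0 q.
    by rewrite le_eqVlt; apply/orP; left; apply/eqP; field; rewrite gt_eqF.
pose X k := 2 * (pi * s k) / pairs_scale (n k).
have W0 k : 0 < pairs_scale (n k) := pairs_scale_gt0 (n0 k).
have X0 k : 0 < X k by rewrite divr_gt0// !mulr_gt0.
have Xcvg : X @ \oo --> Num.sqrt (pi / 2 : R).
  have XE k : X k = Num.sqrt (3 / (2 * pi) * (2 * var_sum (N k) (t k) * t k ^+ 3)).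
    rewrite -[LHS]ger0_norm ?(ltW (X0 k))// -sqrtr_sqr; congr Num.sqrt.
    rewrite /X expr_div_n (pairs_scale2 (n0 k)) -/(t k) !exprMn s2.
    move: (pi : R) p0 (t k) (t0 k) (var_sum _ _) => p p_gt0 u u0 v.
    by field; rewrite !gt_eqF.
  rewrite (funext XE).
  apply: continuous_cvg; first exact: sqrt_continuous.
  have -> : pi / 2 = 3 / (2 * pi) * (pi ^+ 2 / 3) :> R.
    by move: (pi : R) p0 => p p_gt0; field; rewrite gt_eqF.
  apply: cvgM; first exact: cvg_cst.
  apply: (@cvg_dist_le _ _ (fun k => 56 * Num.sqrt (t k))); first by exact: nearW.
  by rewrite -[X in _ --> X](mulr0 56); apply: cvgM => //; exact: cvg_cst.
pose Y k := expR (2 * log_sum (N k) (t k) + (n k)%:R * t k - pi * Num.sqrt (2 * (n k)%:R / 3)).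
have Ycvg : Y @ \oo --> (2^-1 : R).
  have -> : 2^-1 = expR (- ln 2) :> R by rewrite expRN lnK// posrE.
  apply: continuous_cvg; first exact: continuous_expR.
  apply: (@cvg_dist_le _ _ (fun k => 4 * t k)); last first.
    by rewrite -[X in _ --> X](mulr0 4); apply: cvgM => //; exact: cvg_cst.
  apply: nearW => k; have [_ h _ _ _] := NP k.
  rewrite (sqrt_saddle (n0 k)) natrE -/(t k).
  have -> : 2 * log_sum (N k) (t k) + pi ^+ 2 / (6 * t k ^+ 2) * t k - pi * (pi / (3 * t k)) - - ln 2
     = 2 * (log_sum (N k) (t k) - (pi ^+ 2 / 12 / t k - ln 2 / 2)).
    move: (pi : R) (t k) (t0 k) (log_sum _ _) (ln 2) => p u u0 v l.
    by field; rewrite gt_eqF.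
  by rewrite normrM ger0_norm//; lra.
have sq0 : Num.sqrt (pi / 2) != 0 :> R by rewrite gt_eqF// sqrtr_gt0 divr_gt0.
have lim1 : Num.sqrt (2 * pi) * 2^-1 / Num.sqrt (pi / 2) = 1 :> R.
  have -> : 2 * pi = 2 ^+ 2 * (pi / 2) :> R by field.
  rewrite sqrtrM ?sqr_ge0// sqrtr_sqr ger0_norm//.
  by move: (Num.sqrt _) sq0 => q q0; field.
have : (fun k => (size (odd_partition_pairs (n k)))%:R * expR (- ((n k)%:R * t k)) /
    expR (2 * log_sum (N k) (t k)) * (2 * (pi * s k)) * Y k / X k) @ \oo --> (1 : R).
  by rewrite -[X in _ --> X]lim1; apply: cvgM; [exact: cvgM|exact: cvgV].
apply: cvg_trans; apply: near_eq_cvg; apply: nearW => k /=.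
rewrite -/(n k) /pairs_main /X /Y expRB expRD expRN.
have alg (z a b c w v p : R) : 0 < a -> 0 < b -> 0 < c -> 0 < w -> 0 < v -> 0 < p ->
    z / b / a * (2 * (p * v)) * (a * b / c) / (2 * (p * v) / w) = z / (c / w).
  by move=> a0 b0 c0 w0 v0 p0'; field; rewrite !gt_eqF.
by rewrite alg ?expR_gt0.
Qed.

End Asymptotics.

(** * From pairs of partitions back to odd unimodal sequences *)

Lemma sqrtrD_le (R : realType) (b c : R) : 0 < b -> 0 <= c ->
  Num.sqrt (b + c) <= Num.sqrt b + c / 2 / Num.sqrt b.
Proof.
move=> b0 c0; have q0 : 0 < Num.sqrt b by rewrite sqrtr_gt0.
have r0 : 0 <= Num.sqrt b + c / 2 / Num.sqrt b by rewrite addr_ge0 ?divr_ge0 ?(ltW q0).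
rewrite -[leRHS]ger0_norm// -sqrtr_sqr ler_wsqrtr//.
rewrite -{1}[b]sqr_sqrtr ?(ltW b0)//.
have -> : (Num.sqrt b + c / 2 / Num.sqrt b) ^+ 2 =
    Num.sqrt b ^+ 2 + c + (c / 2 / Num.sqrt b) ^+ 2.
  by move: (Num.sqrt b) q0 => q q0; field; rewrite gt_eqF.
by rewrite lerDl sqr_ge0.
Qed.

(** By concavity of the square root, the exponent grows by at most pi (2 / 3) / sqrt (2 n / 3) = 2 t
    when n grows by 2. As t tends to 0, the upper bound pp(n + 2) costs nothing in the limit. *)
Lemma pairs_mainD2_le (R : realType) (n : nat) : (0 < n)%N ->
  pairs_main n.+2 <= pairs_main n * expR (2 * saddle n) :> R.
Proof.
move=> n0; have t0 := @saddle_gt0 R n n0; have p0 := @pi_gt0 R.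
rewrite /pairs_main [leRHS]mulrAC -expRD; apply: ler_pM.
- exact: expR_ge0.
- by rewrite invr_ge0 ltW// pairs_scale_gt0.
- rewrite ler_expR.
  have n0' : 0 < 2 * n%:R / 3 :> R by rewrite divr_gt0// mulr_gt0// ltr0n.
  have := @sqrtrD_le R (2 * n%:R / 3) (4 / 3) n0' ltac:(lra).
  have -> : 2 * n%:R / 3 + 4 / 3 = 2 * n.+2%:R / 3 :> R by rewrite -addn2 natrD; ring.
  move=> /(ler_wpM2l (ltW p0)) /le_trans; apply; rewrite mulrDr lerD2l.
  rewrite (sqrt_saddle n0); move: (pi : R) p0 (saddle n) t0 => p p0 t t0.
  by rewrite le_eqVlt; apply/orP; left; apply/eqP; field; rewrite !gt_eqF.
- rewrite lef_pV2 ?posrE ?pairs_scale_gt0// /pairs_scale.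
  apply: ler_wpM2l; first by rewrite mulr_ge0 ?powR_ge0.
  by apply: ge0_ler_powR; rewrite ?nnegrE ?ler0n// ler_nat; lia.
Qed.

Theorem theorem1p3 (R : realType) :
  (fun n : nat =>
     (ou n)%:R /
     (expR (pi * Num.sqrt (2 * n%:R / 3)) /
      (2 `^ (13 / 4) * 3 `^ (1 / 4) * n%:R `^ (3 / 4))) : R) @ \oo
  --> (1 : R).
Proof.
pose ratio n : R := (size (odd_partition_pairs n))%:R / pairs_main n.
have ratio_cvg : ratio @ \oo --> (1 : R) := size_odd_partition_pairs_asymp.
have two134 : 2 `^ (13 / 4) = 2 * 2 `^ (9 / 4) :> R.
  have -> : 13 / 4 = 1 + 9 / 4 :> R by field.
  by rewrite powRD ?powRr1// implybE pnatr_eq0 orbT.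
have mainE n : expR (pi * Num.sqrt (2 * n%:R / 3)) /
      (2 `^ (13 / 4) * 3 `^ (1 / 4) * n%:R `^ (3 / 4)) = pairs_main n / 2 :> R.
  by rewrite two134 /pairs_main /pairs_scale -!mulrA invfM; ring.
under eq_fun do rewrite mainE.
apply: (@squeeze_cvgr _ _ _ _ ratio (fun n => ratio n.+2 * expR (2 * saddle n))).
- near=> n; have n0 : (0 < n)%N by near: n; exists 1%N.
  have m0 : 0 < pairs_main n :> R by rewrite divr_gt0 ?expR_gt0 ?pairs_scale_gt0.
  have m20 : 0 < pairs_main n.+2 :> R by rewrite divr_gt0 ?expR_gt0 ?pairs_scale_gt0.
  have -> : (ou n)%:R / (pairs_main n / 2) = (ou n).*2%:R / pairs_main n :> R.
    by rewrite -muln2 natrM; field; rewrite gt_eqF.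
  apply/andP; split.
    by apply: ler_wpM2r; [rewrite invr_ge0 ltW|rewrite ler_nat size_pairs_le_ou].
  apply: (@le_trans _ _ ((size (odd_partition_pairs n.+2))%:R / pairs_main n)).
    by apply: ler_wpM2r; [rewrite invr_ge0 ltW|rewrite ler_nat ou_le_size_pairs].
  rewrite /ratio -mulrA; apply: ler_wpM2l => //.
  by rewrite ler_pdivlMl// ler_pdivrMr// mulrC pairs_mainD2_le.
- exact: ratio_cvg.
- rewrite -[X in _ --> X]mulr1; apply: cvgM.
    by have := ratio_cvg; rewrite -(cvg_shiftn 2 ratio) /=; under eq_fun do rewrite addn2.
  have z : (fun n => 2 * saddle n) @ \oo --> (0 : R).
    by rewrite -[X in _ --> X](mulr0 2); apply: cvgM; [exact: cvg_cst|exact: cvg_saddle].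
  rewrite -[X in _ --> X]expR0.
  by apply: continuous_cvg; [exact: continuous_expR|exact: z].
Unshelve. all: by end_near.
Qed.
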